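(* Let $n\ge 1$ and let $F=\alpha\sqrt{\phi(z,\rho)}$ be a (non-degenerate) Finsler metric on $M=\mathbb{R}\times\mathbb{R}^n$, where at a point $x=(x^0,\overline{x})\in\mathbb{R}\times\mathbb{R}^n$ and a tangent vector $y=(y^0,\overline{y})\in\mathbb{R}\times\mathbb{R}^n$ with $\overline{y}\neq 0$ one sets $\alpha=|\overline{y}|$, $z=y^0/|\overline{y}|$, $\rho=|\overline{x}|$ (Euclidean norms). Let $P(z,\rho)$ and $Q(z,\rho)$ be the functions built from $\phi$ and its partial derivatives as defined in the context. Then: (i) if $n\ge 2$, $F$ is Ricci-flat if and only if $P(z,\rho)=0$ and $Q(z,\rho)=0$ for all $(z,\rho)$; (ii) if $n=1$, $F$ is Ricci-flat if and only if $P(z,\rho)+\rho^2Q(z,\rho)=0$ for all $(z,\rho)$.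
   Context: Coordinates on $TM$, $M=\mathbb{R}\times\mathbb{R}^n$: $x=(x^0,\overline{x})$ with $\overline{x}=(x^1,\dots,x^n)$, and $y=(y^0,\overline{y})$ with $\overline{y}=(y^1,\dots,y^n)$. Indices $A,B,C$ range over $0,\dots,n$, and repeated indices are summed. Subscripts $z,\rho$ denote partial derivatives of functions of $(z,\rho)$; brackets with subscripts $x^A$ or $y^A$ denote partial derivatives with respect to those coordinates. Standing assumptions on $\phi$: $\phi=\phi(z,\rho)>0$ is defined for $z\in\mathbb{R}$, $\rho\ge 0$, and is such that $F=\alpha\sqrt{\phi(z,\rho)}$ is a non-degenerate Finsler metric. Concretely, $(z,\overline{x})\mapsto\phi(z,|\overline{x}|)$ is smooth and the functions $$\Omega:=2\phi-z\phi_z,\qquad \Lambda:=2\phi\phi_{zz}-\phi_z^2$$ are nowhere zero. (The positive-definite case is $\Omega,\Lambda>0$.) All quantities are considered at $(x,y)$ with $\overline{y}\ne 0$. Fundamental tensor: $g_{AB}=\tfrac12[F^2]_{y^Ay^B}$, with inverse $(g^{AB})$. Spray coefficients: $G^C=\tfrac14 g^{CA}\left([F^2]_{y^Ax^B}y^B-[F^2]_{x^A}\right)$. Flag curvature tensor (Berwald's formula): $$K^C_B=2[G^C]_{x^B}-[G^C]_{x^Ay^B}y^A+2G^A[G^C]_{y^Ay^B}-[G^C]_{y^A}[G^A]_{y^B}.$$ Ricci curvature: $\mathrm{Ric}=\sum_{A=0}^n K^A_A$, a function of $(x,y)$. $F$ is called Ricci-flat if $\mathrm{Ric}=0$ identically.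 Define $$U:=\frac{1}{2\rho\Lambda}(2\phi\phi_{z\rho}-\phi_z\phi_\rho),\qquad V:=\frac{1}{2\rho\Lambda}(\phi_\rho\phi_{zz}-\phi_z\phi_{z\rho}),\qquad W:=\frac{1}{2\rho\Omega}\phi_\rho,$$ and $$P(z,\rho):=-(2\rho^2W+1)\bigl(U_z+nV+(n-3)W\bigr)-2\bigl(nW+\rho W_\rho-\rho^2W_z(U-zW)\bigr),$$ $$\begin{aligned}Q(z,\rho):={}&2U\bigl(U_{zz}+nV_z+(n-2)W_z\bigr)-\frac1\rho\bigl(U_{z\rho}+nV_\rho+(n-3)W_\rho\bigr)\\&+nV(V+2W)+W\bigl((n-5)W+2zW_z\bigr)+U_z(2W-U_z).\end{aligned}$$ At $\rho=0$ these expressions are understood by continuous extension from $\rho>0$. ''For all $(z,\rho)$'' means for all $z\in\mathbb{R}$ and $\rho\ge 0$. *)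

(* Defs.v *)
From mathcomp Require Import all_boot all_order all_algebra.
From mathcomp Require Import all_classical all_reals all_analysis.

Set Implicit Arguments.
Unset Strict Implicit.
Unset Printing Implicit Defensive.

Import Order.TTheory GRing.Theory Num.Theory.
Import numFieldNormedType.Exports.

Local Open Scope classical_set_scope.
Local Open Scope ring_scope.

Section Smoothness.
Context {R : realType} {V : normedModType R}.

(* On a finite-dimensional V this is the usual class C^k: a C^1 map is
   differentiable, and its directional derivatives are linear in v. *)
Fixpoint Ck (k : nat) (f : V -> R) : Prop :=
  match k with
  | 0 => continuous f
  | k'.+1 => (forall x, differentiable f x) /\ (forall v, Ck k' ('D_v f))
  end.

Definition smooth (f : V -> R) : Prop := forall k, Ck k f.

End Smoothness.

Section Coordinates.
Context {R : realType} {n : nat}.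

(* Both R x R^n and its tangent spaces are 'rV[R]_(n.+1): index ord0 carries
   the R-factor and the indices lift ord0 i carry the R^n-factor. *)
Definition bar (v : 'rV[R]_n.+1) : 'rV[R]_n := \row_(i < n) v ord0 (lift ord0 i).

(* The library norm `|u| on row vectors is the sup norm. *)
Definition enorm (u : 'rV[R]_n) : R := Num.sqrt (\sum_(i < n) u ord0 i ^+ 2).

Definition coordv (A : 'I_n.+1) : 'rV[R]_n.+1 := delta_mx ord0 A.

(* Functions on TM are written f x y. *)
Definition dx (A : 'I_n.+1) (f : 'rV[R]_n.+1 -> 'rV[R]_n.+1 -> R)
    (x y : 'rV[R]_n.+1) : R :=
  'D_(coordv A) (fun x' => f x' y) x.

Definition dy (A : 'I_n.+1) (f : 'rV[R]_n.+1 -> 'rV[R]_n.+1 -> R)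
    (x y : 'rV[R]_n.+1) : R :=
  'D_(coordv A) (fun y' => f x y') y.

End Coordinates.

Section Curvature.
Context {R : realType} {n : nat}.
Implicit Types (F : 'rV[R]_n.+1 -> 'rV[R]_n.+1 -> R) (x y : 'rV[R]_n.+1).

Definition sqF F x y : R := F x y ^+ 2.

Definition fundamental_tensor F x y : 'M[R]_n.+1 :=
  \matrix_(A, B) (2^-1 * dy B (dy A (sqF F)) x y).

Definition spray F (C : 'I_n.+1) x y : R :=
  4^-1 * \sum_A invmx (fundamental_tensor F x y) C A *
    (\sum_B dx B (dy A (sqF F)) x y * y ord0 B - dx A (sqF F) x y).

Definition flag_curvature F (C B : 'I_n.+1) x y : R :=
  2 * dx B (spray F C) x y
  - \sum_A dy B (dx A (spray F C)) x y * y ord0 A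
  + 2 * \sum_A spray F A x y * dy B (dy A (spray F C)) x y
  - \sum_A dy A (spray F C) x y * dy B (spray F A) x y.

Definition Ric F x y : R := \sum_A flag_curvature F A A x y.

(* Only directions outside the axis y-bar = 0 are considered. *)
Definition ricci_flat F : Prop := forall x y, bar y != 0 -> Ric F x y = 0.

End Curvature.

Section CylindricallySymmetric.
Context {R : realType}.
Implicit Types (phi f : R -> R -> R) (z rho : R).

Definition dz f z rho : R := derive1 (fun t => f t rho) z.
Definition drho f z rho : R := derive1 (f z) rho.

Definition Omega phi z rho : R := 2 * phi z rho - z * dz phi z rho.

Definition Lambda phi z rho : R :=
  2 * phi z rho * dz (dz phi) z rho - dz phi z rho ^+ 2.

Definition metricF (n : nat) phi (x y : 'rV[R]_n.+1) : R :=
  enorm (bar y) * Num.sqrt (phi (y ord0 ord0 / enorm (bar y)) (enorm (bar x))).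

(* phi is a total function on R x R; its values at rho < 0 are never
   constrained, and rho-derivatives are only taken at points with rho > 0.
   The last two fields say that metricF phi is non-degenerate: its fundamental
   tensor has determinant Lambda / 4 * (Omega / 2) ^+ n.-1 where bar y != 0. *)
Record admissible (n : nat) phi : Prop := Admissible {
  phi_gt0 : forall z rho, 0 <= rho -> 0 < phi z rho;
  phi_smooth :
    smooth (fun u : 'rV[R]_n.+1 => phi (u ord0 ord0) (enorm (bar u)));
  Omega_neq0 : forall z rho, 0 <= rho -> Omega phi z rho != 0;
  Lambda_neq0 : forall z rho, 0 <= rho -> Lambda phi z rho != 0
}.

Definition fU phi z rho : R :=
  (2 * phi z rho * drho (dz phi) z rho - dz phi z rho * drho phi z rho)
  / (2 * rho * Lambda phi z rho).

Definition fV phi z rho : R :=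
  (drho phi z rho * dz (dz phi) z rho - dz phi z rho * drho (dz phi) z rho)
  / (2 * rho * Lambda phi z rho).

Definition fW phi z rho : R := drho phi z rho / (2 * rho * Omega phi z rho).

(* P0 and Q0 are the formulas for P and Q, meaningful for rho > 0. *)
Definition P0 (n : nat) phi z rho : R :=
  let U := fU phi in let V := fV phi in let W := fW phi in
  - (2 * rho ^+ 2 * W z rho + 1)
    * (dz U z rho + n%:R * V z rho + (n%:R - 3) * W z rho)
  - 2 * (n%:R * W z rho + rho * drho W z rho
         - rho ^+ 2 * dz W z rho * (U z rho - z * W z rho)).

Definition Q0 (n : nat) phi z rho : R :=
  let U := fU phi in let V := fV phi in let W := fW phi in
  2 * U z rho
    * (dz (dz U) z rho + n%:R * dz V z rho + (n%:R - 2) * dz W z rho)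
  - rho^-1
    * (drho (dz U) z rho + n%:R * drho V z rho + (n%:R - 3) * drho W z rho)
  + n%:R * V z rho * (V z rho + 2 * W z rho)
  + W z rho * ((n%:R - 5) * W z rho + 2 * z * dz W z rho)
  + dz U z rho * (2 * W z rho - dz U z rho).

(* When phi is admissible it is a smooth function of (z, rho ^+ 2), so for f := P0
   or Q0 the limit exists and extend0 f is the continuous extension to rho = 0. *)
Definition extend0 f z rho : R :=
  if 0 < rho then f z rho else lim (f z t @[t --> 0^'+]).

Definition P (n : nat) phi : R -> R -> R := extend0 (P0 n phi).
Definition Q (n : nat) phi : R -> R -> R := extend0 (Q0 n phi).

End CylindricallySymmetric.

(* Main.v *)
Require Import Defs.
From HB Require Import structures.
From mathcomp Require Import all_boot all_order all_algebra.
From mathcomp Require Import all_classical all_reals all_analysis.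
From mathcomp Require Import ring lra.

(** The proof computes the spray of [F] explicitly and takes the trace of Berwald's
formula.

Write [r = |y-bar|], [rho = |x-bar|], [z = y0 / r] and [m = <x-bar, y-bar>].  The
fundamental tensor is a multiple of the identity on the spatial directions
orthogonal to [y-bar] and preserves the plane spanned by [y-bar] and the first
coordinate vector, so inverting it amounts to inverting a 2 by 2 matrix of
determinant proportional to [Lambda] ([invmx_fundamental_tensor]).  Where [x-bar != 0] this gives ([spray_model])

   [G^0 = m r (U + z V)],   [G^i = m (V + W) y^i - r^2 W x^i].

Second derivatives of the spray are symmetric ([schwarz]), so the trace may be
taken before the second differentiation: the Ricci curvature depends on the
second derivatives of [G] only through the divergence [N = d G^A / d y^A]
([spray_Ric_divG]), and for the spray above [N] is [m] times
[U_z + (n + 2) V + (n - 1) W].  First derivatives and quadratic sums over the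
indices then yield ([spray_Ric_model], [Ric_off_axis])

   [Ric = r^2 P(z, rho) + m^2 Q(z, rho)]   where [x-bar != 0],

an identity that holds for arbitrary [U], [V], [W], whether or not they come
from a metric.

For [n >= 2] the number [m] is independent of [z], [r] and [rho]: orthogonal
vectors [x-bar], [y-bar] isolate [P], parallel ones then isolate [Q].  For
[n = 1] always [m^2 = r^2 rho^2], so only [P + rho^2 Q] is visible.

There remains the axis [rho = 0].  The curvature is continuous there, since the
inverse of the fundamental tensor, and with it the spray, is smooth wherever
[y-bar != 0] ([smoothTM_spray]); so it vanishes on the axis as soon as it vanishes
elsewhere ([ricci_flat_off_axis]).  Conversely, the values of [P] and [Q] on the axis
are limits.  When [P] and [Q] vanish for [rho > 0] these limits are zero; when
only [P + rho^2 Q] vanishes, one needs in addition that [rho^2 Q] tends to [0]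
([rho2_Q0_cvg]).  This holds because [rho U], [rho V] and [rho W] extend to smooth
functions across [rho = 0] that vanish there.  To have such functions,
[phi] is replaced by its even extension [phi z |rho|], which changes neither [F]
nor [P] and [Q], and which is smooth on the whole plane since it is the
restriction of the smooth function [phi (z, |x-bar|)] to a coordinate plane. *)

Set Implicit Arguments.
Unset Strict Implicit.
Unset Printing Implicit Defensive.

Import Order.TTheory GRing.Theory Num.Theory.
Import numFieldNormedType.Exports.

Local Open Scope classical_set_scope.
Local Open Scope ring_scope.

(** * Functions smooth on an open set *)

(** Differentiability is local: [g - f] vanishes near [x], hence is
    differentiable there with zero differential. *)
Lemma near_eq_differentiable (R : realType) (V : normedModType R)
    (f g : V -> R) (x : V) :
  (\forall y \near x, f y = g y) -> differentiable f x -> differentiable g x.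
Proof.
move=> fg df; set e := g - f.
have e0 : \forall y \near x, e y = 0.
  by apply: filterS fg => y fgy; rewrite /e !fctE fgy subrr.
suff de : differentiable e x.
  by rewrite -[g](subrK f); exact: differentiableD.
apply/diffP => /=.
apply: (@getPex _ (fun (de : {linear V -> R}) => continuous de /\
  forall y, e y = e (lim (nbhs x)) + de (y - lim (nbhs x))
                  +o_(y \near x) (y - lim (nbhs x)))).
exists (\0 : {linear V -> R}); split => /=; first exact: cst_continuous.
rewrite lim_id //.
have : e = (fun y => e x + 0) +o_ (nbhs x) (fun y => y - x).
  have ex := nbhs_singleton e0.
  apply/eqaddoP => _/posnumP[eps]; apply: filterS e0 => z ez.
  by rewrite !fctE /= ez ex addr0 subrr normr0 mulr_ge0.
by move=> /funeqP.
Qed.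

Section SmoothOn.
Context {R : realType} {V : normedModType R}.
Implicit Types (O : set V) (f g : V -> R).

(** Same recursion as [Ck], but on a set: the squared metric is only smooth
    where [y-bar != 0]. *)
Fixpoint Ck_on O (k : nat) f : Prop :=
  match k with
  | 0 => forall x, O x -> {for x, continuous f}
  | k'.+1 => (forall x, O x -> differentiable f x)
             /\ (forall v, Ck_on O k' ('D_v f))
  end.

Definition smooth_on O f : Prop := forall k, Ck_on O k f.

Lemma Ck_on_le O k f : Ck_on O k.+1 f -> Ck_on O k f.
Proof.
elim: k f => [|k IH] f [df Df].
  by move=> x /df /differentiable_continuous.
by split=> // v; apply: IH.
Qed.

(** On an open set equality is equality near each point, so it passes to
    directional derivatives.  The closure rules below rest on this: they identify
    [D_v] of a product, quotient or composite with an expression to which the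
    induction hypothesis applies. *)
Lemma Ck_on_eq O k f g : open O -> (forall x, O x -> f x = g x) ->
  Ck_on O k f -> Ck_on O k g.
Proof.
move=> Oo; have nearO x (P : V -> Prop) : O x -> (forall y, O y -> P y) ->
    \forall y \near x, P y.
  by move=> Ox OP; apply: filterS OP _; exact: open_nbhs_nbhs.
elim: k f g => [|k IH] f g fg.
  move=> fc x Ox; rewrite /prop_for /continuous_at -fg //.
  apply: cvg_trans (fc x Ox); apply: near_eq_cvg.
  exact: nearO.
move=> [df Df]; split=> [x Ox|v].
  by apply: near_eq_differentiable (df x Ox); exact: nearO.
apply: IH (Df v) => x Ox; apply: near_eq_derive; exact: nearO.
Qed.

Lemma smooth_on_differentiable O f x :
  smooth_on O f -> O x -> differentiable f x.
Proof. by move=> /(_ 1) [+ _] => /[apply]. Qed.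

Lemma smooth_on_continuous O f x : smooth_on O f -> O x -> {for x, continuous f}.
Proof. by move=> /(_ 0); exact. Qed.

Lemma smooth_on_derive O f v : smooth_on O f -> smooth_on O ('D_v f).
Proof. by move=> sf k; have [_] := sf k.+1; exact. Qed.

Lemma smooth_on_eq O f g : open O -> (forall x, O x -> f x = g x) ->
  smooth_on O f -> smooth_on O g.
Proof. by move=> Oo fg sf k; apply: Ck_on_eq (sf k). Qed.

Lemma smooth_onS O O' f : O' `<=` O -> smooth_on O f -> smooth_on O' f.
Proof.
move=> O'O sf k; elim: k f sf => [|k IH] f sf.
  by move=> x /O'O; exact: smooth_on_continuous sf.
split=> [x /O'O|v]; first exact: smooth_on_differentiable sf.
exact/IH/smooth_on_derive.
Qed.

Lemma smooth_on_cst O (c : R) : smooth_on O (fun=> c).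
Proof.
move=> k; elim: k c => [|k IH] c; first by move=> x _; exact: cst_continuous.
split=> [x _|v]; first exact: differentiable_cst.
rewrite (_ : 'D_v _ = fun=> 0); first exact: IH.
by apply/funext => x; rewrite derive_cst.
Qed.

Lemma Ck_onD O k f g : open O ->
  Ck_on O k f -> Ck_on O k g -> Ck_on O k (fun x => f x + g x).
Proof.
move=> Oo; elim: k f g => [|k IH] f g.
  by move=> cf cg x Ox; apply: continuousD; [exact: cf|exact: cg].
move=> [df Df] [dg Dg]; split=> [x Ox|v].
  by apply: differentiableD; [exact: df|exact: dg].
apply: Ck_on_eq (IH _ _ (Df v) (Dg v)) => // x Ox.
by rewrite -deriveD //; apply: diff_derivable; [exact: df|exact: dg].
Qed.

Lemma Ck_onM O k f g : open O ->
  Ck_on O k f -> Ck_on O k g -> Ck_on O k (fun x => f x * g x).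
Proof.
move=> Oo; elim: k f g => [|k IH] f g.
  by move=> cf cg x Ox; apply: continuousM; [exact: cf|exact: cg].
move=> Cf Cg; have [df Df] := Cf; have [dg Dg] := Cg; split=> [x Ox|v].
  by apply: differentiableM; [exact: df|exact: dg].
apply: Ck_on_eq (Ck_onD Oo (IH _ _ (Ck_on_le Cf) (Dg v))
                           (IH _ _ (Ck_on_le Cg) (Df v))) => // x Ox.
by rewrite -deriveM //; apply: diff_derivable; [exact: df|exact: dg].
Qed.

Lemma smooth_onD O f g : open O ->
  smooth_on O f -> smooth_on O g -> smooth_on O (fun x => f x + g x).
Proof. by move=> Oo sf sg k; apply: Ck_onD. Qed.

Lemma smooth_onM O f g : open O ->
  smooth_on O f -> smooth_on O g -> smooth_on O (fun x => f x * g x).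
Proof. by move=> Oo sf sg k; apply: Ck_onM. Qed.

Lemma smooth_onN O f : open O -> smooth_on O f -> smooth_on O (fun x => - f x).
Proof.
move=> Oo sf; apply: smooth_on_eq (smooth_onM Oo (@smooth_on_cst O (-1)) sf) => //.
by move=> x _; rewrite mulN1r.
Qed.

Lemma smooth_onB O f g : open O ->
  smooth_on O f -> smooth_on O g -> smooth_on O (fun x => f x - g x).
Proof. by move=> Oo sf sg; apply/smooth_onD/smooth_onN. Qed.

Lemma Ck_on_sum O k n (f : 'I_n -> V -> R) : open O ->
  (forall i, Ck_on O k (f i)) -> Ck_on O k (fun x => \sum_i f i x).
Proof.
move=> Oo; elim: n f => [|n IH] f sf.
  apply: Ck_on_eq (@smooth_on_cst O 0 k) => // x _; by rewrite big_ord0.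
apply: Ck_on_eq (Ck_onD Oo (sf ord0) (IH (fun i => f (lift ord0 i)) _)) => //.
by move=> x _; rewrite big_ord_recl.
Qed.

Lemma smooth_on_sum O n (f : 'I_n -> V -> R) : open O ->
  (forall i, smooth_on O (f i)) -> smooth_on O (fun x => \sum_i f i x).
Proof. by move=> Oo sf k; apply: Ck_on_sum => // i; exact: sf. Qed.

Lemma smooth_onX O f n : open O ->
  smooth_on O f -> smooth_on O (fun x => f x ^+ n).
Proof.
move=> Oo sf; elim: n => [|n IH].
  by apply: smooth_on_eq (@smooth_on_cst O 1) => // x _; rewrite expr0.
by apply: smooth_on_eq (smooth_onM Oo sf IH) => // x _; rewrite exprS.
Qed.

Lemma Ck_onV O k f : open O -> (forall x, O x -> f x != 0) ->
  Ck_on O k f -> Ck_on O k (fun x => (f x)^-1).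
Proof.
move=> Oo f0; elim: k => [|k IH] Cf.
  by move=> x Ox; apply: continuousV; [exact: f0|exact: Cf].
have [df Df] := Cf; split=> [x Ox|v].
  by apply: differentiableV; [exact: df|exact: f0].
have CV := IH (Ck_on_le Cf).
have CN := Ck_onM Oo (@smooth_on_cst O (-1) k) (Df v).
apply: Ck_on_eq (Ck_onM Oo (Ck_onM Oo CV CV) CN) => // x Ox.
rewrite deriveV ?f0 //; last exact/diff_derivable/df.
by rewrite -[RHS]/(_ * _) -exprVn expr2; ring.
Qed.

Lemma smooth_onV O f : open O -> (forall x, O x -> f x != 0) ->
  smooth_on O f -> smooth_on O (fun x => (f x)^-1).
Proof. by move=> Oo f0 sf k; apply: Ck_onV. Qed.

Lemma smooth_on_div O f g : open O -> (forall x, O x -> g x != 0) ->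
  smooth_on O f -> smooth_on O g -> smooth_on O (fun x => f x / g x).
Proof. by move=> Oo g0 sf sg; apply/smooth_onM/smooth_onV. Qed.

(** The derivative of the square root is [f' / (2 sqrt f)], and at each stage
    of the induction [sqrt f] is already known to be [Ck]. *)
Lemma smooth_on_sqrt O f : open O -> (forall x, O x -> 0 < f x) ->
  smooth_on O f -> smooth_on O (fun x => Num.sqrt (f x)).
Proof.
move=> Oo f0 sf.
have dsq x : O x -> differentiable Num.sqrt (f x).
  by move=> Ox; apply/derivable1_diffP; have [] := is_derive1_sqrt (f0 x Ox).
have sq0 x : O x -> Num.sqrt (f x) != 0 by move=> Ox; rewrite gt_eqF ?sqrtr_gt0 ?f0.
elim=> [|k IH].
  move=> x Ox; apply: continuous_comp; first exact: smooth_on_continuous sf _.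
  exact/differentiable_continuous/dsq.
have df x : O x -> differentiable f x by exact: smooth_on_differentiable.
split=> [x Ox|v].
  by apply: differentiable_comp; [exact: df|exact: dsq].
have Cs := Ck_onM Oo (@smooth_on_cst O 2 k) IH.
have CV := Ck_onV Oo _ Cs.
apply: Ck_on_eq (Ck_onM Oo (CV _) (smooth_on_derive v sf k)) => // x Ox; last first.
  by rewrite mulf_neq0 ?sq0 ?pnatr_eq0.
rewrite [RHS]deriveE; last by apply: differentiable_comp; [exact: df|exact: dsq].
rewrite diff_comp; [|exact: df|exact: dsq].
rewrite /= deriv1E; last exact/derivable1_diffP/dsq.
have -> : derive1 Num.sqrt (f x) = (2 * Num.sqrt (f x))^-1.
  by rewrite derive1E; exact/derive_sqrt/f0.
have -> : 'd f x v = 'D_v f x by rewrite deriveE //; exact: df.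
exact: mulrC.
Qed.

Lemma is_derive_linear f x v : linear f -> continuous f -> is_derive x v f (f v).
Proof.
move=> lf cf; pose fM := GRing.isLinear.Build _ _ _ _ f lf.
pose fL : {linear V -> R} := HB.pack f fM.
have df : differentiable f x by exact: (@linear_differentiable _ _ _ fL).
apply: DeriveDef; first exact: diff_derivable.
by rewrite deriveE // (@diff_lin _ _ _ fL).
Qed.

Lemma smooth_on_linear O f : linear f -> continuous f -> smooth_on O f.
Proof.
move=> lf cf; pose fM := GRing.isLinear.Build _ _ _ _ f lf.
pose fL : {linear V -> R} := HB.pack f fM.
have df x : differentiable f x by exact: (@linear_differentiable _ _ _ fL).
case=> [|k]; first by move=> x _; exact: cf.
split=> // v; rewrite (_ : 'D_v f = fun=> f v); first exact: smooth_on_cst.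
by apply/funext => x; case: (is_derive_linear x v lf cf).
Qed.

End SmoothOn.

Section Composition.
Context {R : realType} {V W : normedModType R}.

(** The inner map is given by coordinates [h i] along vectors [e i], so that
    the chain rule is a finite sum [sum_i (D_(e i) f)(H x) * D_v (h i) x] to which
    the rules for sums and products apply. *)
Lemma smooth_on_comp (O : set V) (O' : set W) (n : nat) (h : 'I_n -> V -> R)
    (e : 'I_n -> W) (H : V -> W) (f : W -> R) :
  open O -> (forall x, H x = \sum_i h i x *: e i) ->
  (forall i, smooth_on O (h i)) -> (forall x, O x -> O' (H x)) ->
  smooth_on O' f -> smooth_on O (fun x => f (H x)).
Proof.
move=> Oo HE sh HO sf.
have {}HE : H = \sum_i (fun x => h i x *: e i).
  by apply/funext => x; rewrite HE fct_sumE.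
have dh i x : O x -> differentiable (h i) x by exact: smooth_on_differentiable.
have dhe i x : O x -> differentiable (fun x => h i x *: e i) x.
  by move=> Ox; apply: differentiableZl; exact: dh.
have dH x : O x -> differentiable H x.
  by move=> Ox; rewrite HE; apply: differentiable_sum => i; exact: dhe.
have DH x v : O x -> 'd H x v = \sum_i 'D_v (h i) x *: e i.
  move=> Ox; rewrite -deriveE; last exact: dH.
  rewrite HE derive_sum => [|i]; last exact/diff_derivable/dhe.
  apply: eq_bigr => i _; rewrite deriveE; last exact: dhe.
  by rewrite diffZl ?deriveE//; exact: dh.
move=> k; elim: k f sf => [|k IH] f sf.
  move=> x Ox; apply: continuous_comp; first exact/differentiable_continuous/dH.
  exact: smooth_on_continuous sf (HO _ Ox).
have df x : O x -> differentiable f (H x).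
  by move=> /HO; exact: smooth_on_differentiable.
split=> [x Ox|v].
  by apply: differentiable_comp; [exact: dH|exact: df].
have C i := Ck_onM Oo (smooth_on_derive v (sh i) k) (IH _ (smooth_on_derive (e i) sf)).
apply: Ck_on_eq (Ck_on_sum Oo C) => // x Ox.
rewrite [RHS]deriveE; last by apply: differentiable_comp; [exact: dH|exact: df].
rewrite diff_comp; [|exact: dH|exact: df].
rewrite /= DH // linear_sum; apply: eq_bigr => i _.
by rewrite linearZ (deriveE _ (df x Ox)).
Qed.

End Composition.

(** * Symmetry of second derivatives *)

Section Schwarz.
Context {R : realType} {V : normedModType R}.
Implicit Types (f : V -> R) (x v w : V).

Lemma dist_le (p q s e : R) : `|p - s| < e / 2 -> `|q - s| < e / 2 -> `|p - q| <= e.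
Proof.
move=> ps qs; rewrite -[p](subrK s) -addrA [e]splitr (le_trans (ler_normD _ _)) //.
by rewrite lerD ?ltW // distrC.
Qed.

Lemma subrACA (p q s t : R) : p - q - (s - t) = p - s - (q - t).
Proof. ring. Qed.

Lemma derive_line f x v (s : R) : differentiable f (s *: v + x) ->
  is_derive s 1 (fun t : R => f (t *: v + x)) ('D_v f (s *: v + x)).
Proof.
move=> df.
have dl : differentiable (fun t : R => t *: v + x) s.
  by apply: differentiableD; [exact: differentiableZl|exact: differentiable_cst].
have dc : differentiable (f \o (fun t : R => t *: v + x)) s.
  exact: differentiable_comp.
apply: DeriveDef; first exact/derivable1_diffP.
rewrite deriveE // diff_comp // deriveE //=; congr ('d f _ _).
rewrite -deriveE // deriveD; last 2 first.
- exact/diff_derivable/differentiableZl.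
- exact: derivable_cst.
by rewrite derive_cst addr0 deriveE ?diffZl // -deriveE // derive_id scale1r.
Qed.

Lemma mvt_line f x v (h : R) : 0 < h ->
  (forall s, 0 <= s <= h -> differentiable f (s *: v + x)) ->
  exists2 c, 0 <= c <= h & f (h *: v + x) - f x = h * 'D_v f (c *: v + x).
Proof.
move=> h0 df.
have [||c cI E] := @MVT R (fun t : R => f (t *: v + x))
  (fun t => 'D_v f (t *: v + x)) 0 h h0.
- by move=> s; rewrite in_itv /= => /andP[s0 sh]; apply/derive_line/df; rewrite !ltW.
- apply: derivable_within_continuous => s; rewrite in_itv /= => sI.
  by have [] := derive_line (df s sI).
exists c; first by move: cI; rewrite in_itv /= => /andP[? ?]; rewrite !ltW.
by move: E; rewrite scale0r add0r subr0 mulrC.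
Qed.

(** The mean value theorem along [v], applied to [p |-> f (h w + p) - f p], and
    then along [w], applied to [D_v f]. *)
Lemma second_difference f (O : set V) x v w (h : R) : open O -> smooth_on O f ->
  0 < h -> (forall s t, 0 <= s <= h -> 0 <= t <= h -> O (s *: v + (t *: w + x))) ->
  exists c d, [/\ 0 <= c <= h, 0 <= d <= h &
    (f (h *: v + (h *: w + x)) - f (h *: w + x)) - (f (h *: v + x) - f x) =
    h * h * 'D_w ('D_v f) (c *: v + (d *: w + x))].
Proof.
move=> Oo sf h0 hO.
have hh : 0 <= h <= h by rewrite lexx ltW.
have h00 : 0 <= (0 : R) <= h by rewrite lexx ltW.
pose g p := f (h *: w + p) - f p.
have shift_diff (p q : V) (k : V -> R) : differentiable k (q + p) ->
    differentiable (fun p => k (q + p)) p.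
  move=> dk; have dq : differentiable (fun p : V => q + p) p.
    by apply: (@differentiableD _ _ _ (cst q) id).
  exact: (differentiable_comp dq dk).
have O1 s : 0 <= s <= h -> O (s *: v + x).
  by move=> sI; have := hO s 0 sI h00; rewrite scale0r add0r.
have swap s : h *: w + (s *: v + x) = s *: v + (h *: w + x) by rewrite addrCA.
have dg1 s : 0 <= s <= h -> differentiable (fun p => f (h *: w + p)) (s *: v + x).
  move=> sI; apply: shift_diff; rewrite swap.
  by apply: smooth_on_differentiable sf _; exact: hO.
have dg2 s : 0 <= s <= h -> differentiable f (s *: v + x).
  by move=> /O1; exact: smooth_on_differentiable.
have dg s : 0 <= s <= h -> differentiable g (s *: v + x).
  by move=> sI; apply: differentiableB; [exact: dg1|exact: dg2].
have [c cI Ec] := mvt_line h0 dg.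
have Dg : 'D_v g (c *: v + x) =
    'D_v f (h *: w + (c *: v + x)) - 'D_v f (c *: v + x).
  rewrite deriveB; [|exact/diff_derivable/dg1|exact/diff_derivable/dg2].
  congr (_ - _); rewrite /derive; set F := fun t => _; set G := fun t => _.
  by suff -> : F = G; [|apply/funext => t; rewrite /F /G /= addrCA].
have dD s : 0 <= s <= h -> differentiable ('D_v f) (s *: w + (c *: v + x)).
  move=> sI; apply: smooth_on_differentiable (smooth_on_derive v sf) _.
  by rewrite addrCA; exact: hO.
have [d dI Ed] := mvt_line h0 dD.
exists c, d; split; [exact: cI|exact: dI|].
rewrite [c *: v + (d *: w + x)]addrCA -mulrA -Ed -Dg -Ec /g swap.
exact: subrACA.
Qed.

(** The second difference of [f] over a parallelogram is symmetric in its two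
    sides, so [second_difference] computes it in two ways; let the sides shrink. *)
Lemma schwarz f (O : set V) x v w : open O -> smooth_on O f -> O x ->
  'D_w ('D_v f) x = 'D_v ('D_w f) x.
Proof.
move=> Oo sf Ox; apply/eqP; rewrite -subr_eq0 -normr_eq0; apply/eqP/le_anti.
rewrite normr_ge0 andbT; apply/ler_addgt0Pl => e e0; rewrite addr0.
pose A := 'D_w ('D_v f); pose B := 'D_v ('D_w f).
have cA : {for x, continuous A}.
  exact: smooth_on_continuous (smooth_on_derive w (smooth_on_derive v sf)) Ox.
have cB : {for x, continuous B}.
  exact: smooth_on_continuous (smooth_on_derive v (smooth_on_derive w sf)) Ox.
have e2 : 0 < e / 2 by rewrite divr_gt0.
have nA : \forall y \near x, `|A x - A y| < e / 2.
  by move/cvgrPdist_lt : cA => /(_ _ e2).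
have nB : \forall y \near x, `|B x - B y| < e / 2.
  by move/cvgrPdist_lt : cB => /(_ _ e2).
have nO : \forall y \near x, O y by exact: open_nbhs_nbhs.
have [d /= d0 dP] := (@nbhs_normP _ _ _ _).1 (filterI nO (filterI nA nB)).
pose M := `|v| + `|w| + 1.
have M0 : 0 < M by rewrite ltr_wpDl // addr_ge0.
(* The parallelogram with sides h v and h w lies in the ball of radius d. *)
pose h := d / 2 / M.
have h0 : 0 < h by rewrite !divr_gt0.
have near_x s t : 0 <= s <= h -> 0 <= t <= h ->
    ball_ Num.Def.normr x d (s *: v + (t *: w + x)).
  move=> /andP[s0 sh] /andP[t0 th].
  rewrite /ball_ /= distrC addrA addrK.
  apply: (@le_lt_trans _ _ (h * M)).
    apply: (le_trans (ler_normD _ _)); rewrite !normrZ !ger0_norm //.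
    rewrite /M !mulrDr mulr1 -[leLHS]addr0 !lerD ?ler_wpM2r //; exact: ltW.
  by rewrite /h divfK ?gt_eqF // ltr_pdivrMr // mulr_natr mulr2n ltrDl.
have [|c [c' [cI c'I Ec]]] := @second_difference f O x v w h Oo sf h0.
  by move=> s t sI tI; have [] := dP _ (near_x s t sI tI).
have [|b [b' [bI b'I Eb]]] := @second_difference f O x w v h Oo sf h0.
  by move=> s t sI tI; rewrite addrCA; have [] := dP _ (near_x t s tI sI).
rewrite (addrCA (h *: w) (h *: v) x) in Eb.
have E : A (c *: v + (c' *: w + x)) = B (b *: w + (b' *: v + x)).
  have hh : h * h != 0 by rewrite mulf_neq0 ?gt_eqF.
  apply: (mulfI hh); rewrite -Ec -Eb; exact: subrACA.
have [_ [nA1 _]] := dP _ (near_x _ _ cI c'I).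
have [_ [_ nB1]] := dP _ (near_x _ _ b'I bI).
move: nA1 nB1; rewrite /= -/A -/B E addrCA.
exact: dist_le.
Qed.

End Schwarz.

(** * Rules for directional derivatives *)

Section DirectionalDerivatives.
Context {R : realType} {V : normedModType R}.
Implicit Types (f g : V -> R) (x v : V).

Lemma is_derive_add f g x v df dg : is_derive x v f df -> is_derive x v g dg ->
  is_derive x v (fun x => f x + g x) (df + dg).
Proof. exact: is_deriveD. Qed.

Lemma is_derive_sub f g x v df dg : is_derive x v f df -> is_derive x v g dg ->
  is_derive x v (fun x => f x - g x) (df - dg).
Proof. exact: is_deriveB. Qed.

Lemma is_derive_const c x v : is_derive x v (fun=> c : R) 0.
Proof. exact: is_derive_cst. Qed.

Lemma is_derive_mul f g x v df dg : is_derive x v f df -> is_derive x v g dg ->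
  is_derive x v (fun x => f x * g x) (df * g x + f x * dg).
Proof.
move=> Df Dg; rewrite addrC [df * _]mulrC.
exact: (is_deriveM Df Dg).
Qed.

Lemma is_derive_inv f x v df : f x != 0 -> is_derive x v f df ->
  is_derive x v (fun x => (f x)^-1) (- df / f x ^+ 2).
Proof.
move=> fx0 [df' dfE]; have dV := derivableV fx0 df'.
apply: DeriveDef; first exact: dV.
by rewrite (deriveV fx0 df') dfE mulNr -mulrN mulrC.
Qed.

Lemma is_derive_div f g x v df dg : g x != 0 ->
  is_derive x v f df -> is_derive x v g dg ->
  is_derive x v (fun x => f x / g x) (df / g x - f x * dg / g x ^+ 2).
Proof.
move=> gx0 Df Dg; have := is_derive_mul Df (is_derive_inv gx0 Dg).
by rewrite mulNr mulrN mulrA.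
Qed.

Lemma is_derive_bigsum n (f : 'I_n -> V -> R) (df : 'I_n -> R) x v :
  (forall i, is_derive x v (f i) (df i)) ->
  is_derive x v (fun x => \sum_i f i x) (\sum_i df i).
Proof.
move=> Df; rewrite (_ : (fun _ => _) = \sum_i f i); first exact: is_derive_sum.
by apply/funext => y; rewrite fct_sumE.
Qed.

(** Since [f] is only assumed derivable along [v], everything is read on the line
    through [x] in that direction. *)
Lemma is_derive_comp1 f (g : R -> R) x v df dg :
  is_derive x v f df -> is_derive (f x) 1 g dg ->
  is_derive x v (fun x => g (f x)) (dg * df).
Proof.
move=> [/derivable1P df' dfE] [dg' dgE].
have f0 : f (0 *: v + x) = f x by rewrite scale0r add0r.
have D1 (k : V -> R) : 'D_v k x = derive1 (fun h : R => k (h *: v + x)) 0.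
  rewrite /derive1 /derive; set F := fun h => _; set G := fun h => _.
  suff -> : F = G by [].
  by apply/funext => h; rewrite /F /G /= addr0 scale0r add0r.
have dg0 : derivable g (f (0 *: v + x)) 1 by rewrite f0.
have df1 : differentiable (fun h : R => f (h *: v + x)) 0.
  by move: df' => /derivable1_diffP.
have dg1 : differentiable g (f (0 *: v + x)) by move: dg0 => /derivable1_diffP.
have dgf := differentiable_comp df1 dg1.
apply: DeriveDef; first by apply/derivable1P/derivable1_diffP; exact: dgf.
transitivity (derive1 (g \o (fun h : R => f (h *: v + x))) 0); first exact: D1.
by rewrite (derive1_comp df' dg0) -D1 dfE f0 derive1E dgE.
Qed.

(** Replaces the function and the derivative found by the rules by the wanted
    expressions; the two side goals are pointwise identities. *)
Lemma is_derive_conv f g x v df dg : is_derive x v f df ->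
  (forall y, f y = g y) -> df = dg -> is_derive x v g dg.
Proof. by move=> Df fg <-; rewrite -(_ : f = g) //; apply/funext. Qed.

End DirectionalDerivatives.

(** * Functions of two real variables *)

Section TwoVariables.
Context {R : realType}.
Implicit Types (f g : R -> R -> R) (O : set (R * R)).

Definition smooth2 O f := smooth_on O (fun p : R * R => f p.1 p.2).

(** Partial derivatives are directional derivatives on the product space, which
    gives access to the closure rules for smooth functions. *)
Lemma dzE f z rho :
  dz f z rho = 'D_((1, 0) : R * R) (fun p : R * R => f p.1 p.2) (z, rho).
Proof.
rewrite /dz /derive1 /derive; set F := fun t => _; set G := fun t => _.
suff -> : F = G by []; apply/funext => t; rewrite /F /G /=.
by rewrite scaler0 add0r [_%:A]mulr1.
Qed.

Lemma drhoE f z rho :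
  drho f z rho = 'D_((0, 1) : R * R) (fun p : R * R => f p.1 p.2) (z, rho).
Proof.
rewrite /drho /derive1 /derive; set F := fun t => _; set G := fun t => _.
suff -> : F = G by []; apply/funext => t; rewrite /F /G /=.
by rewrite scaler0 add0r [_%:A]mulr1.
Qed.

Lemma smooth2_dz O f : smooth2 O f -> smooth2 O (dz f).
Proof.
move=> /(smooth_on_derive ((1, 0) : R * R)); congr smooth_on.
by apply/funext => -[z rho]; rewrite dzE.
Qed.

Lemma smooth2_drho O f : smooth2 O f -> smooth2 O (drho f).
Proof.
move=> /(smooth_on_derive ((0, 1) : R * R)); congr smooth_on.
by apply/funext => -[z rho]; rewrite drhoE.
Qed.

Lemma smooth2_derivable_dz O f z rho : smooth2 O f -> O (z, rho) ->
  derivable (f^~ rho) z 1.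
Proof.
move=> sf /(smooth_on_differentiable sf) df; apply/derivable1_diffP.
apply: (@differentiable_comp _ _ _ _ (fun t : R => (t, rho)) _ z _ df).
by apply: differentiable_pair.
Qed.

Lemma smooth2_is_derive_dz O f z rho : smooth2 O f -> O (z, rho) ->
  is_derive z 1 (f^~ rho) (dz f z rho).
Proof.
by move=> sf Oz; rewrite /dz derive1E; apply/derivableP/(smooth2_derivable_dz sf Oz).
Qed.

Lemma smooth2_derivable_drho O f z rho : smooth2 O f -> O (z, rho) ->
  derivable (f z) rho 1.
Proof.
move=> sf /(smooth_on_differentiable sf) df; apply/derivable1_diffP.
apply: (@differentiable_comp _ _ _ _ (fun t : R => (z, t)) _ rho _ df).
by apply: differentiable_pair.
Qed.

Lemma smooth2_is_derive_drho O f z rho : smooth2 O f -> O (z, rho) ->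
  is_derive rho 1 (f z) (drho f z rho).
Proof.
by move=> sf Oz; rewrite /drho derive1E; apply/derivableP/(smooth2_derivable_drho sf Oz).
Qed.

Lemma is_derive_dz f (z rho v : R) : is_derive z 1 (f^~ rho) v -> dz f z rho = v.
Proof. by move=> [_ <-]; rewrite /dz derive1E. Qed.

Lemma is_derive_drho f (z rho v : R) : is_derive rho 1 (f z) v -> drho f z rho = v.
Proof. by move=> [_ <-]; rewrite /drho derive1E. Qed.

Lemma smooth2D O f g : open O -> smooth2 O f -> smooth2 O g ->
  smooth2 O (fun z rho => f z rho + g z rho).
Proof. exact: smooth_onD. Qed.

Lemma smooth2B O f g : open O -> smooth2 O f -> smooth2 O g ->
  smooth2 O (fun z rho => f z rho - g z rho).
Proof. exact: smooth_onB. Qed.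

Lemma smooth2M O f g : open O -> smooth2 O f -> smooth2 O g ->
  smooth2 O (fun z rho => f z rho * g z rho).
Proof. exact: smooth_onM. Qed.

Lemma smooth2_cst O (c : R) : smooth2 O (fun _ _ => c).
Proof. exact: smooth_on_cst. Qed.

Lemma smooth2_div O f g : open O -> (forall z rho, O (z, rho) -> g z rho != 0) ->
  smooth2 O f -> smooth2 O g -> smooth2 O (fun z rho => f z rho / g z rho).
Proof. by move=> Oo g0; apply: smooth_on_div => // -[z rho]; exact: g0. Qed.

Lemma smooth2_z O : smooth2 O (fun z _ => z).
Proof.
apply: smooth_on_linear => [a x y //|x]; exact: cvg_fst.
Qed.

Lemma smooth2_rho O : smooth2 O (fun _ rho => rho).
Proof.
apply: smooth_on_linear => [a x y //|x]; exact: cvg_snd.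
Qed.

End TwoVariables.

(** * Even extension in rho *)

Section EvenExtension.
Context {R : realType}.
Implicit Types (phi psi f g : R -> R -> R).

Lemma smooth_smooth_on (V : normedModType R) (f : V -> R) :
  smooth f -> smooth_on setT f.
Proof.
move=> sf k; have := sf k; elim: k f {sf} => [|k IH] f /=; first by move=> cf x _; exact: cf.
by move=> [df Df]; split=> // v; exact: IH.
Qed.

(** [phi z |rho|] is the restriction of [u |-> phi (u 0) |u-bar|] to the plane
    spanned by the first two coordinate vectors. *)
Lemma smooth2_even n phi :
  smooth (fun u : 'rV[R]_n.+2 => phi (u ord0 ord0) (enorm (bar u))) ->
  smooth2 setT (fun z rho => phi z `|rho|).
Proof.
move=> /smooth_smooth_on sPhi.
pose h (i : 'I_2) (p : R * R) := if i == ord0 then p.1 else p.2.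
pose e (i : 'I_2) : 'rV[R]_n.+2 :=
  if i == ord0 then delta_mx ord0 ord0 else delta_mx ord0 (lift ord0 ord0).
pose H (p : R * R) := \sum_i h i p *: e i.
have HE p : H p = p.1 *: delta_mx ord0 ord0 + p.2 *: delta_mx ord0 (lift ord0 ord0).
  by rewrite /H !big_ord_recl big_ord0 addr0.
have sh i : smooth_on setT (h i).
  by rewrite /h; case: (i == ord0); [exact: smooth2_z|exact: smooth2_rho].
have := @smooth_on_comp R _ _ setT setT 2 h e H _ openT (fun=> erefl) sh
  (fun _ _ => I) sPhi.
congr smooth_on; apply/funext => p; rewrite HE; congr phi.
  by rewrite !mxE /= !mulr1 mulr0 addr0.
rewrite /enorm big_ord_recl big1 => [|i _]; last first.
  by rewrite !mxE /= mulr0 add0r mulr0 expr0n.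
by rewrite !mxE /= mulr0 add0r mulr1 addr0 sqrtr_sqr.
Qed.

(** The properties of the even extension of an admissible function; unlike
    [admissible], they hold at every point of the plane. *)
Record even_regular psi : Prop := EvenRegular {
  er_gt0 : forall z rho, 0 < psi z rho;
  er_smooth : smooth2 setT psi;
  er_even : forall z rho, psi z (- rho) = psi z rho;
  er_Omega : forall z rho, Omega psi z rho != 0;
  er_Lambda : forall z rho, Lambda psi z rho != 0
}.

Lemma admissible_even n phi : (1 <= n)%N -> admissible n phi ->
  even_regular (fun z rho => phi z `|rho|).
Proof.
case: n => // n _ [p0 sp O0 L0]; split.
- by move=> z rho; exact: p0.
- exact: smooth2_even sp.
- by move=> z rho; rewrite normrN.
- by move=> z rho; exact: (O0 z `|rho|).
- by move=> z rho; exact: (L0 z `|rho|).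
Qed.

(** Agreement for [rho > 0] passes to partial derivatives, hence to [P0] and
    [Q0] and to their continuous extensions. *)
Definition eq_pos f g := forall z rho, 0 < rho -> f z rho = g z rho.

Lemma eq_pos_dz f g : eq_pos f g -> eq_pos (dz f) (dz g).
Proof.
move=> fg z rho rho0; rewrite /dz.
by rewrite (_ : (fun t => f t rho) = (fun t => g t rho)) //; apply/funext => t; exact: fg.
Qed.

Lemma eq_pos_drho f g : eq_pos f g -> eq_pos (drho f) (drho g).
Proof.
move=> fg z rho rho0; rewrite /drho !derive1E; apply: near_eq_derive.
by near=> t; apply: fg; near: t; exact: lt_nbhsr.
Unshelve. all: by end_near. Qed.

Lemma eq_pos_fU f g : eq_pos f g -> eq_pos (fU f) (fU g).
Proof.
move=> fg z rho rho0; have fgz := eq_pos_dz fg; have fgzz := eq_pos_dz fgz.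
by rewrite /fU /Lambda (eq_pos_drho fgz) ?fgz ?fgzz ?fg ?(eq_pos_drho fg).
Qed.

Lemma eq_pos_fV f g : eq_pos f g -> eq_pos (fV f) (fV g).
Proof.
move=> fg z rho rho0; have fgz := eq_pos_dz fg; have fgzz := eq_pos_dz fgz.
by rewrite /fV /Lambda (eq_pos_drho fgz) ?fgz ?fgzz ?fg ?(eq_pos_drho fg).
Qed.

Lemma eq_pos_fW f g : eq_pos f g -> eq_pos (fW f) (fW g).
Proof.
move=> fg z rho rho0; have fgz := eq_pos_dz fg.
by rewrite /fW /Omega fgz ?fg ?(eq_pos_drho fg).
Qed.

Lemma eq_pos_P0 n f g : eq_pos f g -> eq_pos (P0 n f) (P0 n g).
Proof.
move=> fg z rho rho0.
have U := eq_pos_fU fg; have V := eq_pos_fV fg; have W := eq_pos_fW fg.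
rewrite /P0 /=; move: (fU f) (fU g) (fV f) (fV g) (fW f) (fW g) U V W => U1 U2 V1 V2 W1 W2 U V W.
have Uz := eq_pos_dz U; have Wz := eq_pos_dz W; have Wr := eq_pos_drho W.
rewrite (U _ _ rho0) (V _ _ rho0) (W _ _ rho0) (Uz _ _ rho0).
by rewrite (Wz _ _ rho0) (Wr _ _ rho0).
Qed.

Lemma eq_pos_Q0 n f g : eq_pos f g -> eq_pos (Q0 n f) (Q0 n g).
Proof.
move=> fg z rho rho0.
have U := eq_pos_fU fg; have V := eq_pos_fV fg; have W := eq_pos_fW fg.
rewrite /Q0 /=; move: (fU f) (fU g) (fV f) (fV g) (fW f) (fW g) U V W => U1 U2 V1 V2 W1 W2 U V W.
have Uz := eq_pos_dz U; have Vz := eq_pos_dz V; have Wz := eq_pos_dz W.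
have Uzz := eq_pos_dz Uz; have Uzr := eq_pos_drho Uz.
have Vr := eq_pos_drho V; have Wr := eq_pos_drho W.
rewrite (U _ _ rho0) (V _ _ rho0) (W _ _ rho0) (Uz _ _ rho0) (Vz _ _ rho0).
by rewrite (Wz _ _ rho0) (Uzz _ _ rho0) (Uzr _ _ rho0) (Vr _ _ rho0) (Wr _ _ rho0).
Qed.

Lemma eq_pos_extend0 f g z rho : eq_pos f g -> extend0 f z rho = extend0 g z rho.
Proof.
move=> fg; rewrite /extend0; case: ifPn => [|_]; first exact: fg.
have -> : f z t @[t --> 0^'+] = g z t @[t --> 0^'+]; last by [].
by rewrite eqEsubset; split; apply: near_eq_cvg; near=> t; rewrite fg.
Unshelve. all: by end_near. Qed.

End EvenExtension.

(** * Behaviour of U, V and W at rho = 0 *)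

Section NearAxis.
Context {R : realType}.
Implicit Types (psi f : R -> R -> R).

(** [rho U], [rho V] and [rho W]: without the division by [rho] these are smooth
    across [rho = 0]. *)
Definition rhoU psi z rho : R :=
  (2 * psi z rho * drho (dz psi) z rho - dz psi z rho * drho psi z rho)
  / (2 * Lambda psi z rho).

Definition rhoV psi z rho : R :=
  (drho psi z rho * dz (dz psi) z rho - dz psi z rho * drho (dz psi) z rho)
  / (2 * Lambda psi z rho).

Definition rhoW psi z rho : R := drho psi z rho / (2 * Omega psi z rho).

Lemma fU_div psi : fU psi = fun z rho => rhoU psi z rho / rho.
Proof.
apply/funext => z; apply/funext => rho.
by rewrite /fU /rhoU mulrAC [in RHS]mulrAC !invfM; ring.
Qed.

Lemma fV_div psi : fV psi = fun z rho => rhoV psi z rho / rho.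
Proof.
apply/funext => z; apply/funext => rho.
by rewrite /fV /rhoV !invfM; ring.
Qed.

Lemma fW_div psi : fW psi = fun z rho => rhoW psi z rho / rho.
Proof.
apply/funext => z; apply/funext => rho.
by rewrite /fW /rhoW !invfM; ring.
Qed.

Variable psi : R -> R -> R.
Hypothesis hpsi : even_regular psi.

Let s_psi : smooth2 setT psi := er_smooth hpsi.

Lemma smooth2_Omega : smooth2 setT (Omega psi).
Proof.
have oT := @openT (R * R)%type; apply: smooth2B => //.
  exact: smooth2M (smooth2_cst _ _) s_psi.
exact: smooth2M (smooth2_z _) (smooth2_dz s_psi).
Qed.

Lemma smooth2_Lambda : smooth2 setT (Lambda psi).
Proof.
have oT := @openT (R * R)%type; apply: smooth2B => //.
  apply: smooth2M => //; first exact: smooth2M (smooth2_cst _ _) s_psi.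
  exact/smooth2_dz/smooth2_dz.
by apply: smooth_onX => //; exact: smooth2_dz.
Qed.

Let Lambda2_neq0 z rho : setT (z, rho) -> 2 * Lambda psi z rho != 0.
Proof. by rewrite mulf_neq0 ?pnatr_eq0 ?er_Lambda. Qed.

Lemma smooth2_rhoU : smooth2 setT (rhoU psi).
Proof.
have oT := @openT (R * R)%type; apply: smooth2_div => //; last first.
  exact: smooth2M (smooth2_cst _ _) smooth2_Lambda.
apply: smooth2B => //; apply: smooth2M => //.
- exact: smooth2M (smooth2_cst _ _) s_psi.
- exact/smooth2_drho/smooth2_dz.
- exact/smooth2_dz.
- exact/smooth2_drho.
Qed.

Lemma smooth2_rhoV : smooth2 setT (rhoV psi).
Proof.
have oT := @openT (R * R)%type; apply: smooth2_div => //; last first.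
  exact: smooth2M (smooth2_cst _ _) smooth2_Lambda.
apply: smooth2B => //; apply: smooth2M => //.
- exact/smooth2_drho.
- exact/smooth2_dz/smooth2_dz.
- exact/smooth2_dz.
- exact/smooth2_drho/smooth2_dz.
Qed.

Lemma smooth2_rhoW : smooth2 setT (rhoW psi).
Proof.
have oT := @openT (R * R)%type; apply: smooth2_div => //.
- by move=> z rho _; rewrite mulf_neq0 ?pnatr_eq0 ?er_Omega.
- exact: smooth2_drho.
- exact: smooth2M (smooth2_cst _ _) smooth2_Omega.
Qed.

End NearAxis.

Section AxisLimit.
Context {R : realType}.
Implicit Types (psi f : R -> R -> R).

Lemma cvg_dnbhs_at_right (f : R -> R) (a l : R) :
  f t @[t --> a^'] --> l -> f t @[t --> a^'+] --> l.
Proof.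
have sub (B : set R) : a^' B -> a^'+ B.
  rewrite /at_right /dnbhs /within /= => aB.
  by apply: filterS aB => t + at0; apply; rewrite gt_eqF.
by move=> fl A /fl /sub.
Qed.

Lemma smooth2_cvg_at_right f z : smooth2 setT f ->
  f z t @[t --> 0^'+] --> f z 0.
Proof.
move=> sf; apply: cvg_at_right_filter.
have := smooth2_derivable_drho (z := z) (rho := 0) sf I.
by move=> /derivable1_diffP/differentiable_continuous; exact.
Qed.

Lemma smooth2_slope_cvg f z : smooth2 setT f -> f z 0 = 0 ->
  f z t / t @[t --> 0^'+] --> drho f z 0.
Proof.
move=> sf f0; apply: cvg_dnbhs_at_right.
have := smooth2_derivable_drho (z := z) (rho := 0) sf I.
move=> /cvg_ex[l]; rewrite /drho derive1E /derive => lP.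
rewrite (cvg_lim _ lP) //.
apply: cvg_trans lP; apply: near_eq_cvg; near=> t.
by rewrite /= addr0 f0 subr0 [_%:A]mulr1 mulrC.
Unshelve. all: by end_near. Qed.

(** If [f] vanishes at [t = 0], both [f_t] and [f / t] tend to [f_t (0)]; their
    difference is [t * d (f / t) / dt]. *)
Lemma smooth2_slope_derive_cvg f z : smooth2 setT f -> f z 0 = 0 ->
  drho f z t - f z t / t @[t --> 0^'+] --> (0 : R).
Proof.
move=> sf f0.
have := cvgB (smooth2_cvg_at_right (z := z) (smooth2_drho sf)) (smooth2_slope_cvg sf f0).
by rewrite subrr; exact.
Qed.

Lemma even_derive0 (f : R -> R) : derivable f 0 1 ->
  (forall t, f (- t) = f t) -> derive1 f 0 = 0.
Proof.
move=> df fe.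
have dN : is_derive (0 : R) 1 -%R (-1) by exact: is_deriveNid.
have dfN : is_derive (- (0 : R)) 1 f ('D_1 f 0) by rewrite oppr0; exact: derivableP.
have [_] := is_derive_comp1 dN dfN.
rewrite (_ : (fun t => f (- t)) = f); last exact/funext.
by rewrite derive1E => E; lra.
Qed.

Lemma dz_div f z t :
  smooth2 setT f -> dz (fun z rho => f z rho / rho) z t = dz f z t / t.
Proof.
move=> sf; rewrite /dz !derive1E.
have df := smooth2_is_derive_dz sf (I : setT (z, t)).
have := is_derive_mul df (is_derive_const t^-1 z 1).
by move=> /@derive_val ->; rewrite mulr0 addr0 /dz derive1E.
Qed.

Lemma drho_div f z t : smooth2 setT f -> t != 0 ->
  drho (fun z rho => f z rho / rho) z t = (drho f z t - f z t / t) / t.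
Proof.
move=> sf t0; rewrite /drho !derive1E.
have df := smooth2_is_derive_drho sf (I : setT (z, t)).
have /@derive_val -> := is_derive_div t0 df (is_derive_id t 1).
by rewrite /drho derive1E; field.
Qed.

Lemma dz_divE f : smooth2 setT f ->
  dz (fun z rho => f z rho / rho) = fun z rho => dz f z rho / rho.
Proof. by move=> sf; apply/funext => z; apply/funext => t; exact: dz_div. Qed.

Lemma dz_eq0 f z t : (forall s, f s t = 0) -> dz f z t = 0.
Proof.
move=> f0; rewrite /dz (_ : (fun s => f s t) = cst 0) ?derive1_cst //.
exact/funext.
Qed.

Variable psi : R -> R -> R.
Hypothesis hpsi : even_regular psi.

Lemma drho_even0 z : drho psi z 0 = 0.
Proof.
apply: even_derive0; last exact: er_even.
exact: (smooth2_derivable_drho (er_smooth hpsi)).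
Qed.

Lemma drho_dz_even0 z : drho (dz psi) z 0 = 0.
Proof.
apply: even_derive0 => [|t].
  exact: (smooth2_derivable_drho (smooth2_dz (er_smooth hpsi))).
by rewrite /dz (_ : (fun s => psi s (- t)) = psi^~ t) //; apply/funext => s; exact: er_even.
Qed.

Lemma rhoU0 z : rhoU psi z 0 = 0.
Proof. by rewrite /rhoU drho_even0 drho_dz_even0 !mulr0 subrr mul0r. Qed.

Lemma rhoV0 z : rhoV psi z 0 = 0.
Proof. by rewrite /rhoV drho_even0 drho_dz_even0 mul0r mulr0 subrr mul0r. Qed.

Lemma rhoW0 z : rhoW psi z 0 = 0.
Proof. by rewrite /rhoW drho_even0 mul0r. Qed.

(** Put [u = rho U], [v = rho V], [w = rho W].  Then [rho^2 Q] is a polynomial in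
    [u], [v], [w], their [z]-derivatives, and the differences
    [f_rho - f / rho] with [f] among [u_z], [v], [w]; all of these tend to [0]. *)
Lemma rho2_Q0_cvg n z : t ^+ 2 * Q0 n psi z t @[t --> 0^'+] --> (0 : R).
Proof.
have sU := smooth2_rhoU hpsi; have sV := smooth2_rhoV hpsi; have sW := smooth2_rhoW hpsi.
rewrite /Q0 fU_div fV_div fW_div /=.
have U0 := rhoU0; have V0 := rhoV0; have W0 := rhoW0.
move: (rhoU psi) (rhoV psi) (rhoW psi) sU sV sW U0 V0 W0 => u v w su sv sw u0 v0 w0.
have suz := smooth2_dz su; have suzz := smooth2_dz suz.
rewrite !dz_divE //.
have dz0 f : (forall z, f z 0 = 0) -> forall z, dz f z 0 = 0.
  by move=> f0 y; exact: dz_eq0.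
have near_t0 : \forall t \near 0^'+, (0 : R) < t by exact: nbhs_right_gt.
suff E : (2 * u z t * (dz (dz u) z t + n%:R * dz v z t + (n%:R - 2) * dz w z t)
    - ((drho (dz u) z t - dz u z t / t) + n%:R * (drho v z t - v z t / t)
       + (n%:R - 3) * (drho w z t - w z t / t))
    + n%:R * v z t * (v z t + 2 * w z t)
    + w z t * ((n%:R - 5) * w z t + 2 * z * dz w z t)
    + dz u z t * (2 * w z t - dz u z t)) @[t --> 0^'+] --> (0 : R).
  apply: cvg_trans E; apply: near_eq_cvg; near=> t.
  have t0 : t != 0 by rewrite gt_eqF //; near: t.
  by rewrite !drho_div //; field.
have L f (sf : smooth2 setT f) : (forall z, f z 0 = 0) ->
    f z t @[t --> 0^'+] --> (0 : R).
  by move=> f0; have := smooth2_cvg_at_right (z := z) sf; rewrite f0; exact.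
have Lu := L u su u0; have Lv := L v sv v0; have Lw := L w sw w0.
have Luz := L _ suz (dz0 _ u0); have Luzz := L _ suzz (dz0 _ (dz0 _ u0)).
have Lvz := L _ (smooth2_dz sv) (dz0 _ v0).
have Lwz := L _ (smooth2_dz sw) (dz0 _ w0).
have Su := smooth2_slope_derive_cvg (z := z) suz (dz0 _ u0 z).
have Sv := smooth2_slope_derive_cvg (z := z) sv (v0 z).
have Sw := smooth2_slope_derive_cvg (z := z) sw (w0 z).
have C (c : R) : (fun=> c) @ (0 : R)^'+ --> c by exact: cvg_cst.
have := cvgD (cvgD (cvgD
  (cvgB (cvgM (cvgM (C 2) Lu)
              (cvgD (cvgD Luzz (cvgM (C n%:R) Lvz)) (cvgM (C (n%:R - 2)) Lwz)))
        (cvgD (cvgD Su (cvgM (C n%:R) Sv)) (cvgM (C (n%:R - 3)) Sw)))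
  (cvgM (cvgM (C n%:R) Lv) (cvgD Lv (cvgM (C 2) Lw))))
  (cvgM Lw (cvgD (cvgM (C (n%:R - 5)) Lw) (cvgM (C (2 * z)) Lwz))))
  (cvgM Luz (cvgB (cvgM (C 2) Lw) Luz)).
by rewrite !(mulr0, addr0, subr0); exact.
Unshelve. all: by end_near. Qed.

End AxisLimit.

(** * Functions on the tangent bundle where y-bar is nonzero *)

Section TangentBundle.
Context {R : realType} {n : nat}.
Local Notation vec := 'rV[R]_n.+1.
Implicit Types (x y : vec) (f g : vec -> vec -> R).

Definition spat (x : vec) (i : 'I_n) : R := x ord0 (lift ord0 i).

(** The directions where the metric is considered, as a subset of the space of
    pairs (x, y). *)
Definition slit : set (vec * vec) := [set p | bar p.2 != 0].

Definition smoothTM f := smooth_on slit (fun p : vec * vec => f p.1 p.2).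

Lemma enormE x : enorm (bar x) = Num.sqrt (\sum_i spat x i ^+ 2).
Proof. by rewrite /enorm; congr Num.sqrt; apply: eq_bigr => i _; rewrite mxE. Qed.

Lemma sum_spat_ge0 x : 0 <= \sum_i spat x i ^+ 2.
Proof. by apply: sumr_ge0 => i _; exact: sqr_ge0. Qed.

Lemma enorm_sqr x : enorm (bar x) ^+ 2 = \sum_i spat x i ^+ 2.
Proof. by rewrite enormE sqr_sqrtr // sum_spat_ge0. Qed.

Lemma bar_neq0 x : (bar x != 0) = (0 < \sum_i spat x i ^+ 2).
Proof.
rewrite lt0r sum_spat_ge0 andbT; apply/negb_inj; rewrite !negbK; apply/eqP/eqP.
  move=> /rowP x0; apply: big1 => i _.
  by have := x0 i; rewrite /bar !mxE /spat => ->; rewrite expr0n.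
move=> /eqP; rewrite psumr_eq0 => [/allP x0|i _]; last exact: sqr_ge0.
apply/rowP => i; rewrite /bar !mxE; apply/eqP; rewrite -sqrf_eq0.
exact: (x0 i (mem_index_enum _)).
Qed.

Lemma enorm_gt0 x : bar x != 0 -> 0 < enorm (bar x).
Proof. by rewrite bar_neq0 enormE sqrtr_gt0. Qed.

Lemma smooth_fst_coord O (A : 'I_n.+1) :
  smooth_on O (fun p : vec * vec => p.1 ord0 A).
Proof.
apply: smooth_on_linear => [a p q|p]; first by rewrite /= !mxE.
have c : {for p, continuous (@fst vec vec)} by exact: cvg_fst.
exact: (continuous_comp c (@coord_continuous _ _ _ ord0 A _)).
Qed.

Lemma smooth_snd_coord O (A : 'I_n.+1) :
  smooth_on O (fun p : vec * vec => p.2 ord0 A).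
Proof.
apply: smooth_on_linear => [a p q|p]; first by rewrite /= !mxE.
have c : {for p, continuous (@snd vec vec)} by exact: cvg_snd.
exact: (continuous_comp c (@coord_continuous _ _ _ ord0 A _)).
Qed.

Lemma smooth_snd_sqnorm O : open O ->
  smooth_on O (fun p : vec * vec => \sum_i spat p.2 i ^+ 2).
Proof.
move=> Oo; apply: smooth_on_sum => // i; apply: smooth_onX => //.
exact: smooth_snd_coord.
Qed.

Lemma open_slit : open slit.
Proof.
rewrite (_ : slit = (fun p : vec * vec => \sum_i spat p.2 i ^+ 2) @^-1` [set t | 0 < t]).
  apply: open_comp; last exact: open_gt.
  move=> p _; exact: smooth_on_continuous (smooth_snd_sqnorm openT) I.
by apply/seteqP; split=> p; rewrite /slit /= bar_neq0.
Qed.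

Lemma bar_open : open [set x : vec | bar x != 0].
Proof.
rewrite (_ : mkset _ = (fun x : vec => (0, x) : vec * vec) @^-1` slit) //.
apply: open_comp => [x _|]; last exact: open_slit.
have d : differentiable (fun x : vec => ((0 : vec), x)) x by apply: differentiable_pair.
exact: (differentiable_continuous d).
Qed.

(** What makes the closure rules and [schwarz] applicable to [dx] and [dy]. *)
Lemma dxE A f x y :
  dx A f x y = 'D_((coordv A, 0) : vec * vec) (fun p : vec * vec => f p.1 p.2) (x, y).
Proof.
rewrite /dx /derive; set F := fun t => _; set G := fun t => _.
suff -> : F = G by []; apply/funext => t; rewrite /F /G /=.
by rewrite scaler0 add0r.
Qed.

Lemma dyE A f x y :
  dy A f x y = 'D_((0, coordv A) : vec * vec) (fun p : vec * vec => f p.1 p.2) (x, y).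
Proof.
rewrite /dy /derive; set F := fun t => _; set G := fun t => _.
suff -> : F = G by []; apply/funext => t; rewrite /F /G /=.
by rewrite scaler0 add0r.
Qed.

Lemma smoothTM_dx A f : smoothTM f -> smoothTM (dx A f).
Proof.
move=> /(smooth_on_derive ((coordv A, 0) : vec * vec)); congr smooth_on.
by apply/funext => -[x y]; rewrite dxE.
Qed.

Lemma smoothTM_dy A f : smoothTM f -> smoothTM (dy A f).
Proof.
move=> /(smooth_on_derive ((0, coordv A) : vec * vec)); congr smooth_on.
by apply/funext => -[x y]; rewrite dyE.
Qed.

Lemma dxdyC A B f x y : smoothTM f -> bar y != 0 ->
  dy B (dx A f) x y = dx A (dy B f) x y.
Proof.
move=> sf y0; rewrite dyE dxE.
rewrite (_ : (fun p : vec * vec => dx A f p.1 p.2) =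
  'D_((coordv A, 0) : vec * vec) (fun p : vec * vec => f p.1 p.2)); last first.
  by apply/funext => -[a b]; rewrite dxE.
rewrite (_ : (fun p : vec * vec => dy B f p.1 p.2) =
  'D_((0, coordv B) : vec * vec) (fun p : vec * vec => f p.1 p.2)); last first.
  by apply/funext => -[a b]; rewrite dyE.
exact: (@schwarz _ _ _ _ (x, y) ((coordv A, 0) : vec * vec) (0, coordv B) open_slit sf y0).
Qed.

Lemma dydyC A B f x y : smoothTM f -> bar y != 0 ->
  dy B (dy A f) x y = dy A (dy B f) x y.
Proof.
move=> sf y0; rewrite (dyE B (dy A f)) (dyE A (dy B f)).
rewrite (_ : (fun p : vec * vec => dy A f p.1 p.2) =
  'D_((0, coordv A) : vec * vec) (fun p : vec * vec => f p.1 p.2)); last first.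
  by apply/funext => -[a b]; rewrite dyE.
rewrite (_ : (fun p : vec * vec => dy B f p.1 p.2) =
  'D_((0, coordv B) : vec * vec) (fun p : vec * vec => f p.1 p.2)); last first.
  by apply/funext => -[a b]; rewrite dyE.
exact: (@schwarz _ _ _ _ (x, y) ((0, coordv A) : vec * vec) (0, coordv B) open_slit sf y0).
Qed.

Lemma smoothTM_derivable_dx A f x y : smoothTM f -> bar y != 0 ->
  derivable (f^~ y) x (coordv A).
Proof.
move=> sf y0; have df : differentiable (fun p : vec * vec => f p.1 p.2) (x, y).
  exact: (smooth_on_differentiable (x := (x, y)) sf y0).
apply: diff_derivable.
apply: (@differentiable_comp _ _ _ _ (fun t : vec => (t, y)) _ x _ df).
by apply: differentiable_pair.
Qed.

Lemma smoothTM_derivable_dy A f x y : smoothTM f -> bar y != 0 ->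
  derivable (f x) y (coordv A).
Proof.
move=> sf y0; have df : differentiable (fun p : vec * vec => f p.1 p.2) (x, y).
  exact: (smooth_on_differentiable (x := (x, y)) sf y0).
apply: diff_derivable.
apply: (@differentiable_comp _ _ _ _ (fun t : vec => (x, t)) _ y _ df).
by apply: differentiable_pair.
Qed.

Lemma smoothTM_is_derive_dx A f x y : smoothTM f -> bar y != 0 ->
  is_derive x (coordv A) (f^~ y) (dx A f x y).
Proof. by move=> sf y0; exact: derivableP (smoothTM_derivable_dx sf y0). Qed.

Lemma smoothTM_is_derive_dy A f x y : smoothTM f -> bar y != 0 ->
  is_derive y (coordv A) (f x) (dy A f x y).
Proof. by move=> sf y0; exact: derivableP (smoothTM_derivable_dy sf y0). Qed.

Lemma is_derive_dx A f x y df : is_derive x (coordv A) (f^~ y) df -> dx A f x y = df.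
Proof. by case. Qed.

Lemma is_derive_dy A f x y df : is_derive y (coordv A) (f x) df -> dy A f x y = df.
Proof. by case. Qed.

Lemma dx_eq_off_axis A f g x y : bar x != 0 ->
  (forall x', bar x' != 0 -> f x' y = g x' y) -> dx A f x y = dx A g x y.
Proof.
move=> x0 fg; apply: near_eq_derive.
by apply: filterS (open_nbhs_nbhs (conj bar_open x0)) => x'; exact: fg.
Qed.

Lemma dy_eq A f g x y : bar y != 0 ->
  (forall y', bar y' != 0 -> f x y' = g x y') -> dy A f x y = dy A g x y.
Proof.
move=> y0 fg; apply: near_eq_derive.
by apply: filterS (open_nbhs_nbhs (conj bar_open y0)) => y'; exact: fg.
Qed.

(** * Ricci curvature as a function of the spray *)

Section Ricci.
Variable G : 'I_n.+1 -> vec -> vec -> R.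
Hypothesis sG : forall C, smoothTM (G C).

(** The trace of Berwald's formula for an arbitrary family [G]: keeping the
    spray abstract separates the curvature computation from the metric. *)
Definition spray_Ric x y : R :=
  \sum_C (2 * dx C (G C) x y - \sum_A dy C (dx A (G C)) x y * y ord0 A
    + 2 * \sum_A G A x y * dy C (dy A (G C)) x y
    - \sum_A dy A (G C) x y * dy C (G A) x y).

Definition divG x y := \sum_C dy C (G C) x y.

Lemma smoothTM_spray_Ric : smoothTM spray_Ric.
Proof.
have oS := open_slit.
have sy A : smoothTM (fun _ y => y ord0 A) by exact: smooth_snd_coord.
have s2 : smoothTM (fun _ _ => 2) by exact: smooth_on_cst.
have sM f g : smoothTM f -> smoothTM g -> smoothTM (fun x y => f x y * g x y).
  exact: smooth_onM.
have sS (k : 'I_n.+1 -> vec -> vec -> R) :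
    (forall A, smoothTM (k A)) -> smoothTM (fun x y => \sum_A k A x y).
  exact: smooth_on_sum.
apply: (sS) => C; apply: smooth_onB => //; first apply: smooth_onD => //.
- apply: smooth_onB => //; first exact: sM s2 (smoothTM_dx _ (sG C)).
  apply: (sS (fun A x y => dy C (dx A (G C)) x y * y ord0 A)) => A.
  exact: sM (smoothTM_dy _ (smoothTM_dx _ (sG C))) (sy A).
- apply: (sM (fun _ _ => 2) (fun x y => \sum_A G A x y * dy C (dy A (G C)) x y) s2).
  apply: (sS (fun A x y => G A x y * dy C (dy A (G C)) x y)) => A.
  exact: sM (sG A) (smoothTM_dy _ (smoothTM_dy _ (sG C))).
- apply: (sS (fun A x y => dy A (G C) x y * dy C (G A) x y)) => A.
  exact: sM (smoothTM_dy _ (sG C)) (smoothTM_dy _ (sG A)).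
Qed.

Lemma dx_divG A x y : bar y != 0 ->
  dx A divG x y = \sum_C dx A (dy C (G C)) x y.
Proof.
move=> y0; apply: is_derive_dx; apply: is_derive_bigsum => C.
exact: smoothTM_is_derive_dx (smoothTM_dy C (sG C)) y0.
Qed.

Lemma dy_divG A x y : bar y != 0 ->
  dy A divG x y = \sum_C dy A (dy C (G C)) x y.
Proof.
move=> y0; apply: is_derive_dy; apply: is_derive_bigsum => C.
exact: smoothTM_is_derive_dy (smoothTM_dy C (sG C)) y0.
Qed.

(** The trace runs over one index of a second derivative of [G]; exchanging the
    two derivatives turns each of these sums into a derivative of [divG]. *)
Lemma spray_Ric_divG x y : bar y != 0 ->
  spray_Ric x y = 2 * (\sum_A dx A (G A) x y)
    - \sum_A dx A divG x y * y ord0 A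
    + 2 * (\sum_A G A x y * dy A divG x y)
    - \sum_C \sum_A dy A (G C) x y * dy C (G A) x y.
Proof.
move=> y0; rewrite /spray_Ric.
rewrite sumrB big_split /= sumrB -!mulr_sumr; congr (_ - _ + _ * _ - _).
  rewrite exchange_big; apply: eq_bigr => A _; rewrite dx_divG // mulr_suml.
  by apply: eq_bigr => C _; rewrite dxdyC.
rewrite exchange_big; apply: eq_bigr => A _; rewrite dy_divG // mulr_sumr.
by apply: eq_bigr => C _; rewrite dydyC.
Qed.

End Ricci.

Lemma RicE F x y : Ric F x y = spray_Ric (spray F) x y.
Proof. by []. Qed.

End TangentBundle.

(** * Derivatives of r, z and m, and sums over indices *)

Section RicciComputation.
Context {R : realType} {n : nat}.
Local Notation vec := 'rV[R]_n.+1.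
Implicit Types (x y w : vec) (f : R -> R -> R).

Definition rad (y : vec) : R := enorm (bar y).
Definition slope (y : vec) : R := y ord0 ord0 / rad y.
Definition bdot (x y : vec) : R := \sum_i spat x i * spat y i.
Definition pos : set (R * R) := [set p | 0 < p.2].

Lemma open_pos : open pos.
Proof.
apply: (@open_comp _ _ (fun p : R * R => p.2) [set t | 0 < t]); last exact: open_gt.
by move=> p _; exact: cvg_snd.
Qed.

Lemma spat_e0 i : spat (coordv ord0 : vec) i = 0.
Proof. by rewrite /spat /coordv mxE. Qed.

Lemma spat_ei i j : spat (coordv (lift ord0 i) : vec) j = (i == j)%:R.
Proof. by rewrite /spat /coordv mxE /= (inj_eq lift_inj) eq_sym. Qed.

Lemma e0_0 : (coordv ord0 : vec) ord0 ord0 = 1.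
Proof. by rewrite /coordv mxE. Qed.

Lemma ei_0 i : (coordv (lift ord0 i) : vec) ord0 ord0 = 0.
Proof. by rewrite /coordv mxE. Qed.

Lemma sum_delta (i : 'I_n) (k : 'I_n -> R) : \sum_j k j * (i == j)%:R = k i.
Proof.
rewrite (bigD1 i) //= eqxx mulr1 big1 ?addr0 // => j /negPf ji.
by rewrite eq_sym ji mulr0.
Qed.

Lemma is_derive_coordinate x w A :
  is_derive x w (fun x : vec => x ord0 A) (w ord0 A).
Proof.
apply: (@is_derive_linear _ _ (fun x : vec => x ord0 A)).
  by move=> a p q; rewrite !mxE.
exact: coord_continuous.
Qed.

Lemma is_derive_spat x w i : is_derive x w (fun x => spat x i) (spat w i).
Proof. exact: is_derive_coordinate. Qed.

Lemma rad_gt0 y : bar y != 0 -> 0 < rad y.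
Proof. exact: enorm_gt0. Qed.

Lemma is_derive_rad y w : bar y != 0 -> is_derive y w rad (bdot y w / rad y).
Proof.
move=> y0; have q0 : 0 < \sum_i spat y i ^+ 2 by rewrite -bar_neq0.
have Dq : is_derive y w (fun y => \sum_i spat y i * spat y i) (2 * bdot y w).
  rewrite /bdot mulr_sumr; apply: is_derive_bigsum => i.
  apply: is_derive_conv (is_derive_mul (is_derive_spat _ _ i) (is_derive_spat _ _ i)) _ _ => //.
  ring.
have qE z : \sum_i spat z i * spat z i = \sum_i spat z i ^+ 2.
  by apply: eq_bigr => i _; rewrite expr2.
have Ds : is_derive (\sum_i spat y i * spat y i) 1 Num.sqrt (2 * rad y)^-1.
  by rewrite qE /rad enormE; exact: is_derive1_sqrt.
apply: is_derive_conv (is_derive_comp1 Dq Ds) _ _ => [z|].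
  by rewrite qE /rad enormE.
by rewrite invfM; field; rewrite gt_eqF // rad_gt0.
Qed.

Lemma is_derive_slope y w : bar y != 0 ->
  is_derive y w slope (w ord0 ord0 / rad y - slope y * (bdot y w / rad y) / rad y).
Proof.
move=> y0; have r0 : rad y != 0 by rewrite gt_eqF // rad_gt0.
apply: is_derive_conv (is_derive_div r0 (is_derive_coordinate y w ord0)
  (is_derive_rad w y0)) _ _ => //.
by rewrite /slope; field.
Qed.

Lemma is_derive_bdot_l x y w : is_derive x w (fun x => bdot x y) (bdot w y).
Proof.
apply: is_derive_bigsum => i.
apply: is_derive_conv (is_derive_mul (is_derive_spat x w i)
  (is_derive_const (spat y i) x w)) _ _ => //.
by rewrite mulr0 addr0.
Qed.

Lemma bdotC x y : bdot x y = bdot y x.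
Proof. by apply: eq_bigr => i _; rewrite mulrC. Qed.

Lemma is_derive_bdot_r x y w : is_derive y w (fun y => bdot x y) (bdot x w).
Proof.
apply: is_derive_conv (is_derive_bdot_l y x w) _ _ => [z|]; exact: bdotC.
Qed.

Lemma bdot_e0 x : bdot x (coordv ord0) = 0.
Proof. by rewrite /bdot big1 // => i _; rewrite spat_e0 mulr0. Qed.

Lemma bdot_ei x i : bdot x (coordv (lift ord0 i)) = spat x i.
Proof.
by rewrite /bdot; under eq_bigr do rewrite spat_ei; rewrite (sum_delta i (spat x)).
Qed.

Lemma bdot_self y : bdot y y = rad y ^+ 2.
Proof. by rewrite /rad enorm_sqr; apply: eq_bigr => i _; rewrite expr2. Qed.

Lemma is_derive_f_slope f rho y w : bar y != 0 ->
  (forall z, derivable (f^~ rho) z 1) ->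
  is_derive y w (fun y => f (slope y) rho)
   (dz f (slope y) rho * (w ord0 ord0 / rad y - slope y * (bdot y w / rad y) / rad y)).
Proof.
move=> y0 df; apply: (is_derive_comp1 (g := f^~ rho) (is_derive_slope w y0)).
by rewrite /dz derive1E; exact: derivableP.
Qed.

Lemma is_derive_f_rad f z x w : bar x != 0 ->
  derivable (f z) (rad x) 1 ->
  is_derive x w (fun x => f z (rad x)) (drho f z (rad x) * (bdot x w / rad x)).
Proof.
move=> x0 df; apply: (is_derive_comp1 (g := f z) (is_derive_rad w x0)).
by rewrite /drho derive1E; exact: derivableP.
Qed.

(** Every single sum over spatial indices below is of this kind; its
    coefficients are supplied by hand and checked by [ring] or [field]. *)
Lemma sum_quadratic x y (k : 'I_n -> R) (al be ga de : R) :
  (forall i, k i = al * (spat x i * spat x i) + be * (spat x i * spat y i)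
                   + ga * (spat y i * spat y i) + de) ->
  \sum_i k i = al * rad x ^+ 2 + be * bdot x y + ga * rad y ^+ 2 + n%:R * de.
Proof.
move=> kE; under eq_bigr do rewrite kE.
rewrite !big_split /= -!mulr_sumr sumr_const card_ord.
by rewrite -!bdot_self [n%:R * de]mulr_natl.
Qed.

(** The trace of the square of the matrix
    [A y x^T + C y y^T + D x y^T + B I]. *)
Lemma trace_square x y (A B C D : R) (k : 'I_n -> 'I_n -> R) :
  (forall i j, k i j = A * (spat y i * spat x j) + C * (spat y i * spat y j)
     + D * (spat x i * spat y j) + B * (i == j)%:R) ->
  \sum_i \sum_j k i j * k j i =
  n%:R * B ^+ 2 + 2 * B * (A * bdot x y + C * rad y ^+ 2 + D * bdot x y)
  + (A ^+ 2 + D ^+ 2) * bdot x y ^+ 2 + C ^+ 2 * rad y ^+ 4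
  + 2 * A * C * bdot x y * rad y ^+ 2 + 2 * A * D * rad x ^+ 2 * rad y ^+ 2
  + 2 * C * D * bdot x y * rad y ^+ 2.
Proof.
move=> kE.
pose T i j := A * (spat y i * spat x j) + C * (spat y i * spat y j) + D * (spat x i * spat y j).
have inner i : \sum_j k i j * k j i =
    \sum_j T i j * T j i + 2 * B * T i i + B ^+ 2.
  (* The square of a Kronecker symbol is that symbol. *)
  transitivity (\sum_j (T i j * T j i + (B * T i j + B * T j i + B ^+ 2) * (i == j)%:R)).
    apply: eq_bigr => j _; rewrite !kE [j == i]eq_sym -/(T i j) -/(T j i).
    by case: (i == j) => /=; ring.
  rewrite big_split /= (sum_delta i (fun j => B * T i j + B * T j i + B ^+ 2)).
  ring.
under eq_bigr do rewrite inner.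
have inner2 i : \sum_j T i j * T j i =
    (A * D * spat y i ^+ 2) * rad x ^+ 2
    + (A * spat y i * (A * spat x i + C * spat y i) + (C * spat y i + D * spat x i) * D * spat y i) * bdot x y
    + (C * spat y i + D * spat x i) * (A * spat x i + C * spat y i) * rad y ^+ 2 + n%:R * 0.
  by apply: sum_quadratic => j; rewrite /T; ring.
under eq_bigr do rewrite inner2.
rewrite (@sum_quadratic x y _ (D * A * rad y ^+ 2)
  (A ^+ 2 * bdot x y + D ^+ 2 * bdot x y + (A * C + C * D) * rad y ^+ 2 + 2 * B * (A + D))
  (A * D * rad x ^+ 2 + A * C * bdot x y + C * D * bdot x y + C ^+ 2 * rad y ^+ 2 + 2 * B * C)
  (B ^+ 2)); first by ring.
by move=> i; rewrite /T; ring.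
Qed.

End RicciComputation.

(** * Ricci curvature of the cylindrically symmetric spray *)

Section SprayRicci.
Context {R : realType} {n : nat}.
Local Notation vec := 'rV[R]_n.+1.
Implicit Types (x y w : vec) (f : R -> R -> R).

(** [P0] and [Q0] as functionals of three arbitrary functions: the curvature
    identity is one about any such triple. *)
Definition Pform (U V W : R -> R -> R) (z rho : R) : R :=
  - (2 * rho ^+ 2 * W z rho + 1)
    * (dz U z rho + n%:R * V z rho + (n%:R - 3) * W z rho)
  - 2 * (n%:R * W z rho + rho * drho W z rho
         - rho ^+ 2 * dz W z rho * (U z rho - z * W z rho)).

Definition Qform (U V W : R -> R -> R) (z rho : R) : R :=
  2 * U z rho
    * (dz (dz U) z rho + n%:R * dz V z rho + (n%:R - 2) * dz W z rho)
  - rho^-1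
    * (drho (dz U) z rho + n%:R * drho V z rho + (n%:R - 3) * drho W z rho)
  + n%:R * V z rho * (V z rho + 2 * W z rho)
  + W z rho * ((n%:R - 5) * W z rho + 2 * z * dz W z rho)
  + dz U z rho * (2 * W z rho - dz U z rho).

Lemma sum_ord_recl2 (h : 'I_n.+1 -> 'I_n.+1 -> R) :
  \sum_C \sum_A h C A = h ord0 ord0 + \sum_i h ord0 (lift ord0 i)
    + \sum_i h (lift ord0 i) ord0
    + \sum_i \sum_j h (lift ord0 i) (lift ord0 j).
Proof.
rewrite big_ord_recl big_ord_recl -!addrA; do 2 congr (_ + _).
by rewrite -big_split; apply: eq_bigr => i _; rewrite big_ord_recl.
Qed.

Variables U W V : R -> R -> R.
Hypotheses (sU : smooth2 pos U) (sV : smooth2 pos V) (sW : smooth2 pos W).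

Let a z rho := U z rho + z * V z rho.
Let b z rho := V z rho + W z rho.
Let t z rho := dz U z rho + (n%:R + 2) * V z rho + (n%:R - 1) * W z rho.

Let sa : smooth2 pos a.
Proof. exact: smooth2D open_pos sU (smooth2M open_pos (smooth2_z _) sV). Qed.

Let sb : smooth2 pos b.
Proof. exact: smooth2D open_pos sV sW. Qed.

Let st : smooth2 pos t.
Proof.
have o := @open_pos R; apply: (smooth2D o).
  exact: (smooth2D o (smooth2_dz sU) (smooth2M o (smooth2_cst _ _) sV)).
exact: (smooth2M o (smooth2_cst _ _) sW).
Qed.

(** The spray of the metric off the axis, with [a = U + z V], [b = V + W]. *)
Definition model_spray (C : 'I_n.+1) x y : R :=
  if unlift ord0 C is Some i
  then bdot x y * b (slope y) (rad x) * spat y i - rad y ^+ 2 * W (slope y) (rad x) * spat x i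
  else bdot x y * rad y * a (slope y) (rad x).

Lemma model_spray0 x y :
  model_spray ord0 x y = bdot x y * rad y * a (slope y) (rad x).
Proof. by rewrite /model_spray unlift_none. Qed.

Lemma model_spray_lift i x y : model_spray (lift ord0 i) x y =
  bdot x y * b (slope y) (rad x) * spat y i - rad y ^+ 2 * W (slope y) (rad x) * spat x i.
Proof. by rewrite /model_spray liftK. Qed.

Section AtPoint.
Variables x y : vec.
Hypotheses (x0 : bar x != 0) (y0 : bar y != 0).
Local Notation z := (slope y).
Local Notation rho := (rad x).
Local Notation r := (rad y).
Local Notation m := (bdot x y).

Let r0 : r != 0. Proof. by rewrite gt_eqF // rad_gt0. Qed.
Let rho0 : rho != 0. Proof. by rewrite gt_eqF // rad_gt0. Qed.

Let pos_rho s : pos (s, rho). Proof. exact: rad_gt0. Qed.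

Lemma is_derive_y f w : smooth2 pos f ->
  is_derive y w (fun y => f (slope y) rho)
   (dz f z rho * (w ord0 ord0 / r - z * (bdot y w / r) / r)).
Proof.
by move=> sf; apply: is_derive_f_slope => // s; exact: (smooth2_derivable_dz sf).
Qed.

Lemma is_derive_x f w : smooth2 pos f ->
  is_derive x w (fun x => f z (rad x)) (drho f z rho * (bdot x w / rho)).
Proof.
by move=> sf; apply: is_derive_f_rad => //; exact: (smooth2_derivable_drho sf).
Qed.

Lemma is_derive_model0_y w :
  is_derive y w (model_spray ord0 x)
    (bdot x w * r * a z rho + m * (bdot y w / r) * a z rho
     + m * r * dz a z rho * (w ord0 ord0 / r - z * (bdot y w / r) / r)).
Proof.
apply: is_derive_conv (is_derive_mul (is_derive_mul (is_derive_bdot_r x y w)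
  (is_derive_rad w y0)) (is_derive_y w sa)) _ _ => [y'|]; last ring.
by rewrite model_spray0.
Qed.

Lemma is_derive_model_y i w :
  is_derive y w (model_spray (lift ord0 i) x)
    ((bdot x w * b z rho
      + m * dz b z rho * (w ord0 ord0 / r - z * (bdot y w / r) / r)) * spat y i
     + m * b z rho * spat w i
     - (2 * bdot y w * W z rho
        + r ^+ 2 * dz W z rho * (w ord0 ord0 / r - z * (bdot y w / r) / r)) * spat x i).
Proof.
apply: is_derive_conv (is_derive_sub
  (is_derive_mul (is_derive_mul (is_derive_bdot_r x y w) (is_derive_y w sb))
    (is_derive_spat y w i))
  (is_derive_mul (is_derive_mul (is_derive_mul (is_derive_rad w y0) (is_derive_rad w y0))
     (is_derive_y w sW)) (is_derive_const (spat x i) y w))) _ _ => [y'|].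
  by rewrite model_spray_lift expr2.
by field.
Qed.

Lemma is_derive_model_x i w :
  is_derive x w (fun x => model_spray (lift ord0 i) x y)
    ((bdot w y * b z rho + m * drho b z rho * (bdot x w / rho)) * spat y i
     - r ^+ 2 * (drho W z rho * (bdot x w / rho) * spat x i + W z rho * spat w i)).
Proof.
apply: is_derive_conv (is_derive_sub
  (is_derive_mul (is_derive_mul (is_derive_bdot_l x y w) (is_derive_x w sb))
    (is_derive_const (spat y i) x w))
  (is_derive_mul (is_derive_mul (is_derive_const (r ^+ 2) x w) (is_derive_x w sW))
     (is_derive_spat x w i))) _ _ => [x'|].
  by rewrite model_spray_lift.
by ring.
Qed.

Lemma dx_model0 : dx ord0 (model_spray ord0) x y = 0.
Proof.
apply: is_derive_dx.
apply: is_derive_conv (is_derive_mul (is_derive_mul (is_derive_bdot_l x y (coordv ord0))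
  (is_derive_const r x _)) (is_derive_x (coordv ord0) sa)) _ _ => [x'|].
  by rewrite model_spray0.
by rewrite bdotC !bdot_e0; ring.
Qed.

Lemma dx_model i : dx (lift ord0 i) (model_spray (lift ord0 i)) x y =
  b z rho * (spat y i * spat y i) + m * drho b z rho / rho * (spat x i * spat y i)
  - r ^+ 2 * drho W z rho / rho * (spat x i * spat x i) - r ^+ 2 * W z rho.
Proof.
rewrite (is_derive_dx (is_derive_model_x i _)) bdotC !bdot_ei spat_ei eqxx mulr1n.
by field.
Qed.

Lemma sum_dx_model : \sum_A dx A (model_spray A) x y =
  r ^+ 2 * (b z rho - rho * drho W z rho - n%:R * W z rho)
  + m ^+ 2 * drho b z rho / rho.
Proof.
rewrite big_ord_recl dx_model0 add0r.
rewrite (@sum_quadratic _ _ x y _ (- (r ^+ 2 * drho W z rho / rho))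
  (m * drho b z rho / rho) (b z rho) (- (r ^+ 2 * W z rho))); first by field.
by move=> i; rewrite dx_model; ring.
Qed.

Lemma dy0_model0 : dy ord0 (model_spray ord0) x y = m * dz a z rho.
Proof.
by rewrite (is_derive_dy (is_derive_model0_y _)) !bdot_e0 e0_0; field.
Qed.

Lemma dy_model0 i : dy (lift ord0 i) (model_spray ord0) x y =
  r * a z rho * spat x i + m * (a z rho - z * dz a z rho) / r * spat y i.
Proof.
by rewrite (is_derive_dy (is_derive_model0_y _)) !bdot_ei ei_0; field.
Qed.

Lemma dy0_model i : dy ord0 (model_spray (lift ord0 i)) x y =
  m * dz b z rho / r * spat y i - r * dz W z rho * spat x i.
Proof.
by rewrite (is_derive_dy (is_derive_model_y _ _)) !bdot_e0 e0_0 spat_e0; field.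
Qed.

Lemma dy_model i j : dy (lift ord0 j) (model_spray (lift ord0 i)) x y =
  b z rho * (spat y i * spat x j) - m * z * dz b z rho / r ^+ 2 * (spat y i * spat y j)
  - (2 * W z rho - z * dz W z rho) * (spat x i * spat y j) + m * b z rho * (i == j)%:R.
Proof.
rewrite (is_derive_dy (is_derive_model_y _ _)) !bdot_ei ei_0 spat_ei [j == i]eq_sym.
by field.
Qed.

Let Dz f (sf : smooth2 pos f) := smooth2_is_derive_dz sf (pos_rho z).
Let Dr f (sf : smooth2 pos f) := smooth2_is_derive_drho sf (pos_rho z).

Lemma dz_a : dz a z rho = dz U z rho + V z rho + z * dz V z rho.
Proof.
rewrite (is_derive_dz (is_derive_add (Dz sU)
  (is_derive_mul (is_derive_id z 1) (Dz sV)))).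
ring.
Qed.

Lemma dz_b : dz b z rho = dz V z rho + dz W z rho.
Proof. exact: is_derive_dz (is_derive_add (Dz sV) (Dz sW)). Qed.

Lemma drho_b : drho b z rho = drho V z rho + drho W z rho.
Proof. exact: is_derive_drho (is_derive_add (Dr sV) (Dr sW)). Qed.

Lemma dz_t : dz t z rho = dz (dz U) z rho + (n%:R + 2) * dz V z rho
  + (n%:R - 1) * dz W z rho.
Proof.
rewrite (is_derive_dz (is_derive_add (is_derive_add (Dz (smooth2_dz sU))
  (is_derive_mul (is_derive_const (n%:R + 2) z 1) (Dz sV)))
  (is_derive_mul (is_derive_const (n%:R - 1) z 1) (Dz sW)))).
ring.
Qed.

Lemma drho_t : drho t z rho = drho (dz U) z rho + (n%:R + 2) * drho V z rho
  + (n%:R - 1) * drho W z rho.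
Proof.
rewrite (is_derive_drho (is_derive_add (is_derive_add (Dr (smooth2_dz sU))
  (is_derive_mul (is_derive_const (n%:R + 2) rho 1) (Dr sV)))
  (is_derive_mul (is_derive_const (n%:R - 1) rho 1) (Dr sW)))).
ring.
Qed.

(** The terms in [W_z] and [z V_z] cancel, which is why [t] has no derivative
    besides [U_z]. *)
Lemma divG_model : divG model_spray x y = m * t z rho.
Proof.
rewrite /divG big_ord_recl dy0_model0.
rewrite (@sum_quadratic _ _ x y _ 0 (b z rho - 2 * W z rho + z * dz W z rho)
  (- (m * z * dz b z rho / r ^+ 2)) (m * b z rho)).
  by rewrite dz_a dz_b /b /t; field.
by move=> i; rewrite dy_model eqxx mulr1n; ring.
Qed.

Let N x y := bdot x y * t (slope y) (rad x).

Lemma dx_N A : dx A N x y = bdot (coordv A) y * t z rho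
  + m * (drho t z rho * (bdot x (coordv A) / rho)).
Proof.
exact: is_derive_dx (is_derive_mul (is_derive_bdot_l x y _) (is_derive_x _ st)).
Qed.

Lemma dy_N A : dy A N x y = bdot x (coordv A) * t z rho
  + m * (dz t z rho * ((coordv A : vec) ord0 ord0 / r - z * (bdot y (coordv A) / r) / r)).
Proof.
exact: is_derive_dy (is_derive_mul (is_derive_bdot_r x y _) (is_derive_y _ st)).
Qed.

Lemma sum_dx_N : \sum_A dx A N x y * y ord0 A =
  r ^+ 2 * t z rho + m ^+ 2 * drho t z rho / rho.
Proof.
rewrite big_ord_recl dx_N bdotC !bdot_e0.
rewrite (@sum_quadratic _ _ x y _ 0 (m * drho t z rho / rho) (t z rho) 0).
  by field.
by move=> i; rewrite dx_N bdotC !bdot_ei -/(spat y i); field.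
Qed.

Lemma sum_dy_N : \sum_A model_spray A x y * dy A N x y =
  m ^+ 2 * U z rho * dz t z rho
  + t z rho * (m ^+ 2 * b z rho - r ^+ 2 * W z rho * rho ^+ 2).
Proof.
rewrite big_ord_recl dy_N model_spray0 !bdot_e0 e0_0.
rewrite (@sum_quadratic _ _ x y _ (- r ^+ 2 * W z rho * t z rho)
  (m * b z rho * t z rho + W z rho * m * dz t z rho * z)
  (- (m * b z rho * m * dz t z rho * z / r ^+ 2)) 0).
  by rewrite /a /b; field.
by move=> i; rewrite dy_N model_spray_lift !bdot_ei ei_0; field.
Qed.

(** Splitting off the index 0 leaves the square of the entry (0, 0), twice the
    product of row 0 and column 0, and the trace of a square of the shape treated in
    [trace_square]. *)
Lemma sum_dy_dy_model :
  \sum_C \sum_A dy A (model_spray C) x y * dy C (model_spray A) x y =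
  (m * dz a z rho) ^+ 2
  + 2 * (m ^+ 2 * dz b z rho * a z rho - r ^+ 2 * rho ^+ 2 * dz W z rho * a z rho
     + m ^+ 2 * (a z rho - z * dz a z rho) * (dz b z rho - dz W z rho))
  + (n%:R * (m * b z rho) ^+ 2
     + 2 * (m * b z rho) * (b z rho * m - m * z * dz b z rho
         - (2 * W z rho - z * dz W z rho) * m)
     + (b z rho ^+ 2 + (2 * W z rho - z * dz W z rho) ^+ 2) * m ^+ 2
     + (m * z * dz b z rho) ^+ 2
     - 2 * b z rho * (m * z * dz b z rho) * m
     - 2 * b z rho * (2 * W z rho - z * dz W z rho) * rho ^+ 2 * r ^+ 2
     + 2 * (m * z * dz b z rho) * (2 * W z rho - z * dz W z rho) * m).
Proof.
pose cross := m * dz b z rho / r * (r * a z rho) * m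
  - r * dz W z rho * (r * a z rho) * rho ^+ 2
  + m * dz b z rho / r * (m * (a z rho - z * dz a z rho) / r) * r ^+ 2
  - r * dz W z rho * (m * (a z rho - z * dz a z rho) / r) * m.
have S1 : \sum_i dy (lift ord0 i) (model_spray ord0) x y
    * dy ord0 (model_spray (lift ord0 i)) x y = cross.
  rewrite (@sum_quadratic _ _ x y _ (- (r * dz W z rho * (r * a z rho)))
    (m * dz b z rho / r * (r * a z rho)
       - r * dz W z rho * (m * (a z rho - z * dz a z rho) / r))
    (m * dz b z rho / r * (m * (a z rho - z * dz a z rho) / r)) 0).
    by rewrite /cross; ring.
  by move=> i; rewrite dy_model0 dy0_model; ring.
have S2 : \sum_i dy ord0 (model_spray (lift ord0 i)) x y
    * dy (lift ord0 i) (model_spray ord0) x y = cross.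
  by rewrite -S1; apply: eq_bigr => i _; rewrite mulrC.
have S3 := @trace_square _ _ x y (b z rho) (m * b z rho)
  (- (m * z * dz b z rho / r ^+ 2)) (- (2 * W z rho - z * dz W z rho))
  (fun i j => dy (lift ord0 j) (model_spray (lift ord0 i)) x y).
rewrite (sum_ord_recl2 (fun C A => dy A (model_spray C) x y * dy C (model_spray A) x y)).
transitivity ((m * dz a z rho) ^+ 2 + cross + cross +
  (\sum_i \sum_j dy (lift ord0 j) (model_spray (lift ord0 i)) x y
     * dy (lift ord0 i) (model_spray (lift ord0 j)) x y)).
  by congr (_ + _ + _ + _); [rewrite dy0_model0 expr2|exact: S1|exact: S2].
rewrite S3 => [|i j]; last by rewrite dy_model; ring.
by rewrite /cross; field.
Qed.

End AtPoint.

(** All derivatives are local and [G] agrees with the model near the point,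
    so the sums computed for the model apply; the rest is an identity of rational
    functions in the values and derivatives of [U], [V], [W]. *)
Lemma spray_Ric_model (G : 'I_n.+1 -> vec -> vec -> R) x y :
  (forall C, smoothTM (G C)) ->
  (forall C x y, bar x != 0 -> bar y != 0 -> G C x y = model_spray C x y) ->
  bar x != 0 -> bar y != 0 ->
  spray_Ric G x y = rad y ^+ 2 * Pform U V W (slope y) (rad x)
    + bdot x y ^+ 2 * Qform U V W (slope y) (rad x).
Proof.
move=> sG hG x0 y0.
have dxG A : dx A (G A) x y = dx A (model_spray A) x y.
  by apply: dx_eq_off_axis => // x' x'0; exact: hG.
have dyG A C x' y' : bar x' != 0 -> bar y' != 0 ->
    dy A (G C) x' y' = dy A (model_spray C) x' y'.
  by move=> x'0 y'0; apply: dy_eq => // w w0; exact: hG.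
have NE x' y' : bar x' != 0 -> bar y' != 0 ->
    divG G x' y' = bdot x' y' * t (slope y') (rad x').
  move=> x'0 y'0; rewrite -divG_model //; apply: eq_bigr => C _; exact: dyG.
rewrite spray_Ric_divG //.
have -> : \sum_A dx A (G A) x y = \sum_A dx A (model_spray A) x y.
  by apply: eq_bigr => A _; exact: dxG.
rewrite sum_dx_model //.
have -> : \sum_A dx A (divG G) x y * y ord0 A =
    \sum_A dx A (fun x y => bdot x y * t (slope y) (rad x)) x y * y ord0 A.
  apply: eq_bigr => A _; congr (_ * _); apply: dx_eq_off_axis => // x' x'0.
  exact: NE.
rewrite sum_dx_N //.
have -> : \sum_A G A x y * dy A (divG G) x y =
    \sum_A model_spray A x y * dy A (fun x y => bdot x y * t (slope y) (rad x)) x y.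
  apply: eq_bigr => A _; rewrite hG //; congr (_ * _); apply: dy_eq => // y' y'0.
  exact: NE.
rewrite sum_dy_N //.
have -> : \sum_C \sum_A dy A (G C) x y * dy C (G A) x y =
    \sum_C \sum_A dy A (model_spray C) x y * dy C (model_spray A) x y.
  by apply: eq_bigr => C _; apply: eq_bigr => A _; rewrite !dyG.
rewrite sum_dy_dy_model // dz_a // dz_b // drho_b // dz_t // drho_t //.
have rho0 : rad x != 0 by rewrite gt_eqF // rad_gt0.
rewrite /Pform /Qform /a /b /t.
by field.
Qed.

End SprayRicci.

(** * Axially symmetric matrices *)

Section BlockMatrix.
Context {R : fieldType} {n : nat}.

(** Entries of a symmetric matrix that is invariant under the spatial isometries
    fixing [Y]; the inverse of such a matrix is again of this shape. *)
Definition axial_entry (p q s t : R) (Y : 'I_n -> R) (A B : 'I_n.+1) : R :=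
  match unlift ord0 A, unlift ord0 B with
  | None, None => p
  | None, Some j => q * Y j
  | Some i, None => q * Y i
  | Some i, Some j => s * (i == j)%:R + t * (Y i * Y j)
  end.

Lemma axial_00 p q s t Y : axial_entry p q s t Y ord0 ord0 = p.
Proof. by rewrite /axial_entry unlift_none. Qed.

Lemma axial_0l p q s t Y j : axial_entry p q s t Y ord0 (lift ord0 j) = q * Y j.
Proof. by rewrite /axial_entry unlift_none liftK. Qed.

Lemma axial_l0 p q s t Y i : axial_entry p q s t Y (lift ord0 i) ord0 = q * Y i.
Proof. by rewrite /axial_entry unlift_none liftK. Qed.

Lemma axial_ll p q s t Y i j : axial_entry p q s t Y (lift ord0 i) (lift ord0 j) =
  s * (i == j)%:R + t * (Y i * Y j).
Proof. by rewrite /axial_entry !liftK. Qed.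

Definition axialE := (axial_00, axial_0l, axial_l0, axial_ll).

Lemma axial_mul1 (p q s t p' q' s' t' S : R) (Y : 'I_n -> R) :
  \sum_i Y i ^+ 2 = S ->
  p * p' + q * q' * S = 1 -> p * q' + q * s' + q * t' * S = 0 ->
  q * p' + s * q' + t * q' * S = 0 -> s * s' = 1 ->
  q * q' + s * t' + t * s' + t * t' * S = 0 ->
  (\matrix_(A, B) axial_entry p q s t Y A B) *m (\matrix_(A, B) axial_entry p' q' s' t' Y A B)
    = 1%:M.
Proof.
move=> YS E00 E0j Ei0 Ess Eij; apply/matrixP => A B.
rewrite !mxE big_ord_recl !mxE.
under eq_bigr do rewrite !mxE.
have sumd (i : 'I_n) (k : 'I_n -> R) : \sum_j k j * (i == j)%:R = k i.
  rewrite (bigD1 i) //= eqxx mulr1 big1 ?addr0 // => j /negPf ji.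
  by rewrite eq_sym ji mulr0.
have sumE (c : R) (f : 'I_n -> R) :
    (forall k, f k = c * Y k ^+ 2) -> \sum_k f k = c * S.
  by move=> fE; rewrite -YS mulr_sumr; apply: eq_bigr => k _.
case: (unliftP ord0 A) => [i|] ->; case: (unliftP ord0 B) => [j|] ->;
  (under eq_bigr do rewrite !axialE); rewrite !axialE ?(inj_eq lift_inj) ?eqxx.
- have -> : \sum_k (s * (i == k)%:R + t * (Y i * Y k)) *
      (s' * (k == j)%:R + t' * (Y k * Y j)) =
      s * (s' * (i == j)%:R + t' * (Y i * Y j)) + t * s' * (Y i * Y j)
      + t * t' * (Y i * Y j) * S.
    transitivity (\sum_k (s * (s' * (k == j)%:R + t' * (Y k * Y j)) * (i == k)%:R
        + t * s' * (Y i * Y k) * (j == k)%:R + t * t' * (Y i * Y j) * Y k ^+ 2)).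
      by apply: eq_bigr => k _; rewrite [j == k]eq_sym; ring.
    rewrite !big_split /= (sumd i (fun k => s * (s' * (k == j)%:R + t' * (Y k * Y j)))).
    by rewrite (sumd j (fun k => t * s' * (Y i * Y k))) (@sumE (t * t' * (Y i * Y j))).
  transitivity (s * s' * (i == j)%:R
    + (q * q' + s * t' + t * s' + t * t' * S) * (Y i * Y j)); first ring.
  by rewrite Ess Eij mul1r mul0r addr0.
- have -> : \sum_k (s * (i == k)%:R + t * (Y i * Y k)) * (q' * Y k) =
      s * q' * Y i + t * q' * Y i * S.
    transitivity (\sum_k (s * q' * Y k * (i == k)%:R + t * q' * Y i * Y k ^+ 2)).
      by apply: eq_bigr => k _; ring.
    rewrite big_split /= (sumd i (fun k => s * q' * Y k)).
    by rewrite (@sumE (t * q' * Y i)).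
  transitivity ((q * p' + s * q' + t * q' * S) * Y i); first ring.
  by rewrite Ei0 mul0r.
- have -> : \sum_k q * Y k * (s' * (k == j)%:R + t' * (Y k * Y j)) =
      q * s' * Y j + q * t' * Y j * S.
    transitivity (\sum_k (q * s' * Y k * (j == k)%:R + q * t' * Y j * Y k ^+ 2)).
      by apply: eq_bigr => k _; rewrite [j == k]eq_sym; ring.
    rewrite big_split /= (sumd j (fun k => q * s' * Y k)).
    by rewrite (@sumE (q * t' * Y j)).
  transitivity ((p * q' + q * s' + q * t' * S) * Y j); first ring.
  by rewrite E0j mul0r.
- rewrite (sumE (q * q')) ?E00 // => k; ring.
Qed.

End BlockMatrix.

(** * The spray of the metric *)

Section MetricSpray.
Context {R : realType} {n : nat}.
Local Notation vec := 'rV[R]_n.+1.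
Implicit Types (x y w : vec) (f : R -> R -> R).

Definition cyl_smooth f := smooth_on setT (fun u : vec => f (u ord0 ord0) (rad u)).

Lemma smoothTM_rad : smoothTM (fun _ y : vec => rad y).
Proof.
have o := @open_slit R n.
have : smooth_on slit (fun p : vec * vec => Num.sqrt (\sum_i spat p.2 i ^+ 2)).
  apply: smooth_on_sqrt => //; last exact: smooth_snd_sqnorm.
  by move=> p; rewrite /slit /= bar_neq0.
by congr smooth_on; apply/funext => p; rewrite /rad enormE.
Qed.

Lemma smoothTM_y A : smoothTM (fun _ y : vec => y ord0 A).
Proof. exact: smooth_snd_coord. Qed.

Lemma slit_rad0 (p : vec * vec) : slit p -> rad p.2 != 0.
Proof. by move=> p0; rewrite gt_eqF // rad_gt0. Qed.

Lemma smoothTM_slope : smoothTM (fun _ y : vec => slope y).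
Proof.
exact: smooth_on_div open_slit slit_rad0 (smoothTM_y ord0) smoothTM_rad.
Qed.

(** The point [(z, x-bar)] depends smoothly on (x, y) where [y-bar != 0], also at
    [x-bar = 0], whereas [rho] alone does not. *)
Lemma cyl_smooth_pullback f : cyl_smooth f -> smoothTM (fun x y => f (slope y) (rad x)).
Proof.
move=> sf.
pose h (C : 'I_n.+1) (p : vec * vec) : R :=
  if unlift ord0 C is Some i then spat p.1 i else slope p.2.
pose H (p : vec * vec) : vec := \row_C h C p.
have sh C : smooth_on slit (h C).
  rewrite /h; case: (unliftP ord0 C) => [i|] _; last exact: smoothTM_slope.
  exact: smooth_fst_coord.
have HE p : H p = \sum_C h C p *: delta_mx ord0 C.
  by rewrite [LHS]row_sum_delta; apply: eq_bigr => C _; rewrite !mxE.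
have := smooth_on_comp (@open_slit R n) HE sh (fun _ _ => I) sf.
congr smooth_on; apply/funext => p; congr f.
  by rewrite !mxE /h unlift_none.
rewrite /rad; congr enorm; apply/rowP => i.
by rewrite !mxE /h liftK.
Qed.

Lemma cyl_smooth_dz f : cyl_smooth f -> cyl_smooth (dz f).
Proof.
move=> /(smooth_on_derive (delta_mx ord0 ord0 : vec)); congr smooth_on.
apply/funext => u; rewrite /dz /derive1 /derive.
set F := fun t => _; set G := fun t => _.
suff -> : F = G by []; apply/funext => t; rewrite /F /G /=.
rewrite !mxE /= mulr1; congr (_ *: (f _ _ - _)).
by rewrite /rad; congr enorm; apply/rowP => i; rewrite !mxE /= mulr0 add0r.
Qed.

Variable psi : R -> R -> R.
Hypotheses (hpsi : even_regular psi) (spsi : cyl_smooth psi).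

Local Notation F := (@metricF R n psi).

Lemma sqF_metricF x y : sqF F x y = rad y ^+ 2 * psi (slope y) (rad x).
Proof. by rewrite /sqF /metricF exprMn (sqr_sqrtr (ltW (er_gt0 hpsi _ _))). Qed.

Lemma smoothTM_sqF : smoothTM (sqF F).
Proof.
have o := @open_slit R n.
have := smooth_onM o (smooth_onX 2 o smoothTM_rad) (cyl_smooth_pullback spsi).
by congr smooth_on; apply/funext => p; rewrite sqF_metricF.
Qed.

Let derivable_z f rho : smooth2 setT f -> forall z, derivable (f^~ rho) z 1.
Proof. by move=> sf z; exact: (smooth2_derivable_dz sf). Qed.

Let s1 := er_smooth hpsi.
Let s2 := smooth2_dz s1.
Let sO := smooth2_Omega hpsi.

Lemma dz_Omega z rho : dz (Omega psi) z rho = dz psi z rho - z * dz (dz psi) z rho.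
Proof.
have D := is_derive_sub
  (is_derive_mul (is_derive_const 2 z 1) (smooth2_is_derive_dz s1 (I : setT (z, rho))))
  (is_derive_mul (is_derive_id z 1) (smooth2_is_derive_dz s2 (I : setT (z, rho)))).
rewrite (@is_derive_dz _ (Omega psi) _ _ _ D); ring.
Qed.

Lemma drho_Omega z rho :
  drho (Omega psi) z rho = 2 * drho psi z rho - z * drho (dz psi) z rho.
Proof.
have D := is_derive_sub
  (is_derive_mul (is_derive_const 2 rho 1) (smooth2_is_derive_drho s1 (I : setT (z, rho))))
  (is_derive_mul (is_derive_const z rho 1) (smooth2_is_derive_drho s2 (I : setT (z, rho)))).
rewrite (@is_derive_drho _ (Omega psi) _ _ _ D); ring.
Qed.

Lemma is_derive_sqF x y w : bar y != 0 ->
  is_derive y w (sqF F x)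
    (2 * bdot y w * psi (slope y) (rad x) + rad y ^+ 2 * (dz psi (slope y) (rad x)
       * (w ord0 ord0 / rad y - slope y * (bdot y w / rad y) / rad y))).
Proof.
move=> y0; have r0 : rad y != 0 by rewrite gt_eqF // rad_gt0.
apply: is_derive_conv (is_derive_mul (is_derive_mul (is_derive_rad w y0) (is_derive_rad w y0))
  (is_derive_f_slope w y0 (derivable_z (rho := rad x) s1))) _ _ => [y'|].
  by rewrite sqF_metricF expr2.
by field.
Qed.

Lemma dy0_sqF x y : bar y != 0 -> dy ord0 (sqF F) x y = rad y * dz psi (slope y) (rad x).
Proof.
move=> y0; have r0 : rad y != 0 by rewrite gt_eqF // rad_gt0.
by rewrite (is_derive_dy (is_derive_sqF x (coordv ord0) y0)) bdot_e0 e0_0; field.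
Qed.

Lemma dy_sqF i x y : bar y != 0 ->
  dy (lift ord0 i) (sqF F) x y = spat y i * Omega psi (slope y) (rad x).
Proof.
move=> y0; have r0 : rad y != 0 by rewrite gt_eqF // rad_gt0.
rewrite (is_derive_dy (is_derive_sqF x (coordv (lift ord0 i)) y0)) bdot_ei ei_0 /Omega.
by field.
Qed.

Lemma fundamental_tensorE x y : bar y != 0 ->
  fundamental_tensor F x y = \matrix_(A, B) axial_entry
    (dz (dz psi) (slope y) (rad x) / 2) (dz (Omega psi) (slope y) (rad x) / (2 * rad y))
    (Omega psi (slope y) (rad x) / 2)
    (- (slope y * dz (Omega psi) (slope y) (rad x)) / (2 * rad y ^+ 2)) (spat y) A B.
Proof.
move=> y0; have r0 : rad y != 0 by rewrite gt_eqF // rad_gt0.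
apply/matrixP => A B; rewrite !mxE.
have D0 w : is_derive y w (fun y => rad y * dz psi (slope y) (rad x)) _ :=
  is_derive_mul (is_derive_rad w y0) (is_derive_f_slope w y0 (derivable_z (rho := rad x) s2)).
have Di i w : is_derive y w (fun y => spat y i * Omega psi (slope y) (rad x)) _ :=
  is_derive_mul (is_derive_spat y w i) (is_derive_f_slope w y0 (derivable_z (rho := rad x) sO)).
case: (unliftP ord0 A) => [i|] ->; last first.
  rewrite (dy_eq _ (g := fun x y => rad y * dz psi (slope y) (rad x))) //; last first.
    by move=> y'; exact: dy0_sqF.
  rewrite (is_derive_dy (D0 _)).
  case: (unliftP ord0 B) => [j|] ->; rewrite axialE ?bdot_e0 ?bdot_ei ?e0_0 ?ei_0 ?dz_Omega.
    by field.
  by field.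
rewrite (dy_eq _ (g := fun x y => spat y i * Omega psi (slope y) (rad x))) //; last first.
  by move=> y'; exact: dy_sqF.
rewrite (is_derive_dy (Di _ _)).
case: (unliftP ord0 B) => [j|] ->;
  rewrite axialE ?bdot_e0 ?bdot_ei ?e0_0 ?ei_0 ?spat_e0 ?spat_ei ?dz_Omega.
  by rewrite [j == i]eq_sym; field.
by field.
Qed.

(** In the basis formed by the first coordinate vector and [y-bar / r] of the plane
    they span, the tensor is, up to the factor 1/2, the matrix with rows
    [phi_zz, Omega_z] and [Omega_z, Omega - z Omega_z], of determinant [Lambda]; on the orthogonal complement it is [Omega / 2]. *)
Definition inv_tensor x y : 'M[R]_n.+1 :=
  \matrix_(A, B) axial_entry
    (2 * (Omega psi (slope y) (rad x) - slope y * dz (Omega psi) (slope y) (rad x))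
       / Lambda psi (slope y) (rad x))
    (- 2 * dz (Omega psi) (slope y) (rad x) / (rad y * Lambda psi (slope y) (rad x)))
    (2 / Omega psi (slope y) (rad x))
    ((2 * dz (dz psi) (slope y) (rad x) / Lambda psi (slope y) (rad x)
       - 2 / Omega psi (slope y) (rad x)) / rad y ^+ 2) (spat y) A B.

Lemma invmx_fundamental_tensor x y : bar y != 0 ->
  invmx (fundamental_tensor F x y) = inv_tensor x y.
Proof.
move=> y0; have r0 : rad y != 0 by rewrite gt_eqF // rad_gt0.
have O0 := er_Omega hpsi (slope y) (rad x); have L0 := er_Lambda hpsi (slope y) (rad x).
have hg : inv_tensor x y *m fundamental_tensor F x y = 1%:M.
  rewrite fundamental_tensorE // /inv_tensor.
  move: O0 L0; rewrite dz_Omega /Omega /Lambda.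
  have rE := bdot_self y.
  move: (slope y) (rad y) r0 rE => z r r0 rE.
  move: (psi z (rad x)) (dz psi z (rad x)) (dz (dz psi) z (rad x)) => p a b O0 L0.
  have q2 : (2 : R) != 0 by rewrite pnatr_eq0.
  apply: (@axial_mul1 _ _ _ _ _ _ _ _ _ _ (r ^+ 2)).
  - by rewrite -rE; apply: eq_bigr => i _; rewrite expr2.
  - by field; rewrite r0 L0.
  - by field; rewrite r0 L0.
  - by field; rewrite r0 L0 O0.
  - by field.
  - by field; rewrite r0 L0 O0.
have [_ ug] := mulmx1_unit hg.
by rewrite -[LHS]mul1mx -hg -mulmxA mulmxV // mulmx1.
Qed.

(** The entries involve only [z]-derivatives of the metric function, and
    these are smooth across [x-bar = 0]. *)
Lemma smoothTM_inv_tensor A B : smoothTM (fun x y => inv_tensor x y A B).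
Proof.
have o := @open_slit R n.
have sM (k h : vec -> vec -> R) :
    smoothTM k -> smoothTM h -> smoothTM (fun x y => k x y * h x y).
  exact: smooth_onM o.
have sB (k h : vec -> vec -> R) :
    smoothTM k -> smoothTM h -> smoothTM (fun x y => k x y - h x y).
  exact: smooth_onB o.
have sD (k h : vec -> vec -> R) : (forall x y, bar y != 0 -> h x y != 0) ->
    smoothTM k -> smoothTM h -> smoothTM (fun x y => k x y / h x y).
  by move=> g0; apply: smooth_on_div o _ => -[x y]; exact: g0.
have sC (c : R) : smoothTM (fun _ _ : vec => c) by exact: smooth_on_cst.
have s0 := cyl_smooth_pullback spsi.
have sa := cyl_smooth_pullback (cyl_smooth_dz spsi).
have sb := cyl_smooth_pullback (cyl_smooth_dz (cyl_smooth_dz spsi)).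
have sz := smoothTM_slope; have sr := smoothTM_rad.
have sOm : smoothTM (fun x y => Omega psi (slope y) (rad x)).
  exact: sB (sM _ _ (sC 2) s0) (sM _ _ sz sa).
have sOz : smoothTM (fun x y => dz (Omega psi) (slope y) (rad x)).
  have := sB _ _ sa (sM _ _ sz sb).
  by congr smooth_on; apply/funext => p; rewrite dz_Omega.
have sL : smoothTM (fun x y => Lambda psi (slope y) (rad x)).
  exact: sB (sM _ _ (sM _ _ (sC 2) s0) sb) (smooth_onX 2 o sa).
have O0 x y : bar y != 0 -> Omega psi (slope y) (rad x) != 0 by move=> _; exact: er_Omega.
have L0 x y : bar y != 0 -> Lambda psi (slope y) (rad x) != 0 by move=> _; exact: er_Lambda.
have r0 (x y : vec) : bar y != 0 -> rad y != 0 by move=> y0; rewrite gt_eqF // rad_gt0.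
have sy i : smoothTM (fun _ y : vec => spat y i) by exact: smoothTM_y.
have spp : smoothTM (fun x y => 2 * (Omega psi (slope y) (rad x)
    - slope y * dz (Omega psi) (slope y) (rad x)) / Lambda psi (slope y) (rad x)).
  apply: (sD _ _ L0) => //; exact: sM (sC 2) (sB _ _ sOm (sM _ _ sz sOz)).
have sq : smoothTM (fun x y =>
    - 2 * dz (Omega psi) (slope y) (rad x) / (rad y * Lambda psi (slope y) (rad x))).
  apply: (sD); last exact: sM sr sL.
    by move=> x y y0; rewrite mulf_neq0 ?L0 // (r0 x).
  exact: sM (sC (- 2)) sOz.
have ss : smoothTM (fun x y => 2 / Omega psi (slope y) (rad x)).
  exact: (sD _ _ O0 (sC 2) sOm).
have st : smoothTM (fun x y => (2 * dz (dz psi) (slope y) (rad x) / Lambda psi (slope y) (rad x)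
       - 2 / Omega psi (slope y) (rad x)) / rad y ^+ 2).
  apply: (sD); last exact: (smooth_onX 2 o sr).
    by move=> x y y0; rewrite expf_neq0 // (r0 x).
  exact: sB (sD _ _ L0 (sM _ _ (sC 2) sb) sL) ss.
case: (unliftP ord0 A) => [i|] ->; case: (unliftP ord0 B) => [j|] ->.
- have := smooth_onD o (sM _ _ ss (sC (i == j)%:R)) (sM _ _ st (sM _ _ (sy i) (sy j))).
  by congr smooth_on; apply/funext => p; rewrite mxE axialE.
- have := sM _ _ sq (sy i).
  by congr smooth_on; apply/funext => p; rewrite mxE axialE.
- have := sM _ _ sq (sy j).
  by congr smooth_on; apply/funext => p; rewrite mxE axialE.
- by move: spp; congr smooth_on; apply/funext => p; rewrite mxE axialE.
Qed.

(** Four times the right-hand side of the linear system solved by the spray. *)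
Definition force A x y : R :=
  \sum_B dx B (dy A (sqF F)) x y * y ord0 B - dx A (sqF F) x y.

Lemma smoothTM_force A : smoothTM (force A).
Proof.
have o := @open_slit R n; apply: smooth_onB => //; last exact: smoothTM_dx smoothTM_sqF.
apply: smooth_on_sum => // B.
exact: smooth_onM o (smoothTM_dx _ (smoothTM_dy _ smoothTM_sqF)) (smoothTM_y B).
Qed.

Lemma sprayE C x y : bar y != 0 ->
  spray F C x y = 4^-1 * \sum_A inv_tensor x y C A * force A x y.
Proof. by move=> y0; rewrite /spray invmx_fundamental_tensor. Qed.

(** This includes the points with [x-bar = 0], where the expression of the spray
    by [U], [V], [W] is not available. *)
Lemma smoothTM_spray C : smoothTM (spray F C).
Proof.
have o := @open_slit R n.
have sS : smooth_on slit (fun p : vec * vec =>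
    4^-1 * \sum_A inv_tensor p.1 p.2 C A * force A p.1 p.2).
  apply: smooth_onM => //; first exact: smooth_on_cst.
  apply: smooth_on_sum => // A.
  exact: smooth_onM o (smoothTM_inv_tensor C A) (smoothTM_force A).
by apply: smooth_on_eq sS => // p p0; rewrite sprayE.
Qed.

Let derivable_rho f x z : smooth2 setT f -> bar x != 0 -> derivable (f z) (rad x) 1.
Proof. by move=> sf _; exact: (smooth2_derivable_drho sf). Qed.

Lemma dx_sqF A x y : bar x != 0 ->
  dx A (sqF F) x y = rad y ^+ 2 * (drho psi (slope y) (rad x) * (bdot x (coordv A) / rad x)).
Proof.
move=> x0; apply: is_derive_dx.
apply: is_derive_conv (is_derive_mul (is_derive_const (rad y ^+ 2) x (coordv A))
  (is_derive_f_rad (coordv A) x0 (derivable_rho (z := slope y) s1 x0))) _ _ => [x'|].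
  by rewrite sqF_metricF.
ring.
Qed.

Lemma force0 x y : bar x != 0 -> bar y != 0 ->
  force ord0 x y = rad y * drho (dz psi) (slope y) (rad x) * bdot x y / rad x.
Proof.
move=> x0 y0; have rho0 : rad x != 0 by rewrite gt_eqF // rad_gt0.
rewrite /force dx_sqF // bdot_e0 mul0r !mulr0 subr0.
have D B : dx B (dy ord0 (sqF F)) x y =
    rad y * (drho (dz psi) (slope y) (rad x) * (bdot x (coordv B) / rad x)).
  apply: is_derive_dx.
  apply: is_derive_conv (is_derive_mul (is_derive_const (rad y) x (coordv B))
    (is_derive_f_rad (coordv B) x0 (derivable_rho (z := slope y) s2 x0))) _ _ => [x'|].
    by rewrite dy0_sqF.
  ring.
rewrite big_ord_recl D bdot_e0.
rewrite (@sum_quadratic _ _ x y _ 0 (rad y * drho (dz psi) (slope y) (rad x) / rad x) 0 0).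
  by field.
by move=> i; rewrite D bdot_ei -/(spat y i); field.
Qed.

Lemma force_lift i x y : bar x != 0 -> bar y != 0 ->
  force (lift ord0 i) x y =
    drho (Omega psi) (slope y) (rad x) * bdot x y / rad x * spat y i
    - rad y ^+ 2 * drho psi (slope y) (rad x) / rad x * spat x i.
Proof.
move=> x0 y0; have rho0 : rad x != 0 by rewrite gt_eqF // rad_gt0.
rewrite /force dx_sqF // bdot_ei.
have D B : dx B (dy (lift ord0 i) (sqF F)) x y =
    spat y i * (drho (Omega psi) (slope y) (rad x) * (bdot x (coordv B) / rad x)).
  apply: is_derive_dx.
  apply: is_derive_conv (is_derive_mul (is_derive_const (spat y i) x (coordv B))
    (is_derive_f_rad (coordv B) x0 (derivable_rho (z := slope y) sO x0))) _ _ => [x'|].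
    by rewrite dy_sqF.
  ring.
rewrite big_ord_recl D bdot_e0.
rewrite (@sum_quadratic _ _ x y _ 0 (spat y i * drho (Omega psi) (slope y) (rad x) / rad x) 0 0).
  by field.
by move=> j; rewrite D bdot_ei -/(spat y j); field.
Qed.

(** Multiplying [force] by the inverse tensor; [V] is the coefficient common to
    [y^0] and [y^i] in the part of the spray proportional to [y]. *)
Lemma spray_model C x y : bar x != 0 -> bar y != 0 ->
  spray F C x y = model_spray (fU psi) (fW psi) (fV psi) C x y.
Proof.
move=> x0 y0; rewrite sprayE //.
have r0 : rad y != 0 by rewrite gt_eqF // rad_gt0.
have rho0 : rad x != 0 by rewrite gt_eqF // rad_gt0.
have O0 := er_Omega hpsi (slope y) (rad x); have L0 := er_Lambda hpsi (slope y) (rad x).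
have S : \sum_i spat y i * force (lift ord0 i) x y =
    rad y ^+ 2 * (drho psi (slope y) (rad x) - slope y * drho (dz psi) (slope y) (rad x))
      * bdot x y / rad x.
  rewrite (@sum_quadratic _ _ x y _ 0 (- (rad y ^+ 2 * drho psi (slope y) (rad x) / rad x))
    (drho (Omega psi) (slope y) (rad x) * bdot x y / rad x) 0).
    by rewrite drho_Omega; field.
  by move=> i; rewrite force_lift //; ring.
rewrite big_ord_recl force0 // mxE.
case: (unliftP ord0 C) => [i|] ->.
  have -> : \sum_j inv_tensor x y (lift ord0 i) (lift ord0 j) * force (lift ord0 j) x y =
      2 / Omega psi (slope y) (rad x) * force (lift ord0 i) x y
      + ((2 * dz (dz psi) (slope y) (rad x) / Lambda psi (slope y) (rad x)
       - 2 / Omega psi (slope y) (rad x)) / rad y ^+ 2) * spat y i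
       * \sum_j spat y j * force (lift ord0 j) x y.
    rewrite -(sum_delta i (fun j => 2 / Omega psi (slope y) (rad x) * force (lift ord0 j) x y)).
    rewrite mulr_sumr -big_split; apply: eq_bigr => j _.
    by rewrite mxE axialE /=; ring.
  rewrite S force_lift // axialE model_spray_lift drho_Omega dz_Omega.
  rewrite /fU /fV /fW.
  move: O0 L0; rewrite /Omega /Lambda.
  move: (slope y) (rad y) (rad x) r0 rho0 => z r rho r0 rho0.
  move: (psi z rho) (dz psi z rho) (dz (dz psi) z rho) (drho psi z rho)
    (drho (dz psi) z rho) => p a b pr ar O0 L0.
  by field; rewrite r0 L0 O0 rho0.
have -> : \sum_j inv_tensor x y ord0 (lift ord0 j) * force (lift ord0 j) x y =
    - 2 * dz (Omega psi) (slope y) (rad x) / (rad y * Lambda psi (slope y) (rad x))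
       * \sum_j spat y j * force (lift ord0 j) x y.
  by rewrite mulr_sumr; apply: eq_bigr => j _; rewrite mxE axialE mulrA.
rewrite S axialE model_spray0 dz_Omega /fU /fV.
move: O0 L0; rewrite /Omega /Lambda.
move: (slope y) (rad y) (rad x) r0 rho0 => z r rho r0 rho0.
move: (psi z rho) (dz psi z rho) (dz (dz psi) z rho) (drho psi z rho)
  (drho (dz psi) z rho) => p a b pr ar O0 L0.
by field; rewrite r0 L0 rho0.
Qed.

End MetricSpray.

(** * Ricci-flatness *)

Section MainTheorem.
Context {R : realType}.
Implicit Types (psi : R -> R -> R) (z rho : R).

Lemma continuous_eq0 (f : R -> R) : {for 0, continuous f} ->
  (forall t, t != 0 -> f t = 0) -> f 0 = 0.
Proof.
move=> cf f0.
have c1 : f t @[t --> 0^'] --> f 0 by exact: cvg_within_filter.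
have c2 : f t @[t --> 0^'] --> (0 : R).
  have c0 : (fun=> 0 : R) @ (0 : R)^' --> (0 : R) by exact: cvg_cst.
  apply: cvg_trans c0; apply: near_eq_cvg; near=> t.
  by rewrite f0 //; near: t; exact: nbhs_dnbhs_neq.
exact: (cvg_unique _ c1 c2).
Unshelve. all: by end_near. Qed.

Section Metric.
Context {n : nat}.
Local Notation vec := 'rV[R]_n.+1.
Implicit Types (x y : vec).

Variable psi : R -> R -> R.
Hypotheses (hpsi : even_regular psi) (spsi : @cyl_smooth R n psi).
Local Notation F := (@metricF R n psi).

(** [U], [V], [W] are smooth for [rho > 0], so the spray computed in
    [spray_model] falls under [spray_Ric_model]. *)
Lemma Ric_off_axis x y : bar x != 0 -> bar y != 0 ->
  Ric F x y = rad y ^+ 2 * P0 n psi (slope y) (rad x)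
    + bdot x y ^+ 2 * Q0 n psi (slope y) (rad x).
Proof.
have o := @open_pos R.
have sub : @pos R `<=` setT by [].
have p0 (z rho : R) : pos (z, rho) -> rho != 0 by move=> /gt_eqF ->.
have sU : smooth2 pos (fU psi).
  rewrite fU_div; apply: smooth2_div => //; last exact: smooth2_rho.
  exact: smooth_onS sub (smooth2_rhoU hpsi).
have sV : smooth2 pos (fV psi).
  rewrite fV_div; apply: smooth2_div => //; last exact: smooth2_rho.
  exact: smooth_onS sub (smooth2_rhoV hpsi).
have sW : smooth2 pos (fW psi).
  rewrite fW_div; apply: smooth2_div => //; last exact: smooth2_rho.
  exact: smooth_onS sub (smooth2_rhoW hpsi).
move=> x0 y0; rewrite RicE.
exact: (spray_Ric_model sU sV sW (smoothTM_spray hpsi spsi)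
  (spray_model hpsi) x0 y0).
Qed.

(** Test vectors with [z] prescribed and [x-bar], [y-bar] along coordinate axes. *)
Definition plane_vec (a b : R) (i : 'I_n) : vec :=
  a *: coordv ord0 + b *: coordv (lift ord0 i).

Lemma plane_vec_0 a b i : plane_vec a b i ord0 ord0 = a.
Proof. by rewrite /plane_vec !mxE /= mulr1 mulr0 addr0. Qed.

Lemma spat_plane_vec a b i j : spat (plane_vec a b i) j = b * (i == j)%:R.
Proof.
by rewrite -spat_ei /spat /plane_vec !mxE /= mulr0 add0r.
Qed.

Lemma bdot_plane_vec a b i c d j :
  bdot (plane_vec a b i) (plane_vec c d j) = b * d * (i == j)%:R.
Proof.
rewrite /bdot -[RHS](sum_delta j (fun k => b * d * (i == k)%:R)).
by apply: eq_bigr => k _; rewrite !spat_plane_vec; ring.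
Qed.

Lemma rad_plane_vec a b i : 0 <= b -> rad (plane_vec a b i) = b.
Proof.
move=> b0; have E := bdot_self (plane_vec a b i).
rewrite bdot_plane_vec eqxx mulr1 -expr2 in E.
by apply/esym/(pexpIrn (n := 2)); rewrite ?nnegrE // /rad enormE sqrtr_ge0.
Qed.

Lemma bar_plane_vec a b i : 0 < b -> bar (plane_vec a b i) != 0.
Proof.
move=> b0; have E := rad_plane_vec a i (ltW b0).
apply/eqP => v0; move: b0; rewrite -E /rad v0 /enorm big1 ?sqrtr0 ?ltxx // => k _.
by rewrite mxE expr0n.
Qed.

(** A point of the axis is the limit of points [x + t e] off the axis, and
    the curvature is continuous. *)
Lemma ricci_flat_off_axis (i0 : 'I_n) :
  (forall x y, bar x != 0 -> bar y != 0 -> Ric F x y = 0) -> ricci_flat F.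
Proof.
move=> h x y y0; have [x0|x0] := boolP (bar x != 0); first exact: h.
pose e := coordv (lift ord0 i0) : vec.
have bar_t t : t != 0 -> bar (t *: e + x) != 0.
  move=> t0; apply: contra t0 => /eqP /rowP /(_ i0) /eqP.
  move: x0; rewrite negbK => /eqP /rowP /(_ i0).
  by rewrite /bar !mxE /= eqxx mulr1 => ->; rewrite addr0.
rewrite -[x]add0r -(scale0r e).
apply: (@continuous_eq0 (fun t : R => Ric F (t *: e + x) y)) => [|t t0]; last first.
  by apply: h => //; exact: bar_t.
have sRic := smoothTM_spray_Ric (smoothTM_spray hpsi spsi).
have dl : differentiable (fun t : R => (t *: e + x, y) : vec * vec) 0.
  by apply: differentiable_pair => //; apply: differentiableD => //.
have dR : differentiable (fun p : vec * vec => Ric F p.1 p.2) (0 *: e + x, y).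
  exact: (smooth_on_differentiable (x := (0 *: e + x, y)) sRic y0).
exact: (differentiable_continuous (differentiable_comp dl dR)).
Qed.

(** With [x-bar = rho e_i], [y-bar = e_j] one has [r = 1] and [m = rho delta_ij]. *)
Lemma ricci_flat_coeff (i j : 'I_n) z rho : ricci_flat F -> 0 < rho ->
  P0 n psi z rho + (rho * (i == j)%:R) ^+ 2 * Q0 n psi z rho = 0.
Proof.
move=> Rf rho0.
pose x : vec := plane_vec 0 rho i; pose y : vec := plane_vec z 1 j.
have y0 : bar y != 0 := bar_plane_vec z j ltr01.
have x0 : bar x != 0 := bar_plane_vec 0 i rho0.
have ry : rad y = 1 := rad_plane_vec z j ler01.
have rx : rad x = rho := rad_plane_vec 0 i (ltW rho0).
have zy : slope y = z by rewrite /slope ry divr1 plane_vec_0.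
have mxy : bdot x y = rho * (i == j)%:R by rewrite bdot_plane_vec mulr1.
have := Rf x y y0; rewrite (Ric_off_axis x0 y0) ry rx zy mxy.
by rewrite expr1n mul1r.
Qed.

End Metric.

Lemma extend0_pos (f : R -> R -> R) z rho : 0 < rho -> extend0 f z rho = f z rho.
Proof. by rewrite /extend0 => ->. Qed.

Lemma extend0_axis (f : R -> R -> R) z (l : R) :
  f z t @[t --> 0^'+] --> l -> extend0 f z 0 = l.
Proof. by rewrite /extend0 ltxx => /cvg_lim; apply. Qed.

Lemma near_eq0_at_right (f g : R -> R) :
  (forall t, 0 < t -> f t = g t) -> g t @[t --> 0^'+] --> (0 : R) ->
  f t @[t --> 0^'+] --> (0 : R).
Proof.
move=> fg g0; apply: cvg_trans g0; apply: near_eq_cvg; near=> t.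
by rewrite fg //; near: t; exact: nbhs_right_gt.
Unshelve. all: by end_near. Qed.

End MainTheorem.

Theorem theorem1 (R : realType) (n : nat) (phi : R -> R -> R)
    (hn : (1 <= n)%N) (hphi : admissible n phi) :
  ((2 <= n)%N ->
     (ricci_flat (@metricF R n phi) <->
      forall z rho : R, 0 <= rho -> P n phi z rho = 0 /\ Q n phi z rho = 0)) /\
  (n = 1%N ->
     (ricci_flat (@metricF R n phi) <->
      forall z rho : R, 0 <= rho -> P n phi z rho + rho ^+ 2 * Q n phi z rho = 0)).
Proof.
pose psi (z rho : R) := phi z `|rho|.
have hpsi : even_regular psi by exact: admissible_even hn hphi.
have spsi : @cyl_smooth R n psi.
  have := smooth_smooth_on (phi_smooth hphi).
  congr smooth_on; apply/funext => u.
  by rewrite /psi ger0_norm // sqrtr_ge0.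
have FE : @metricF R n phi = @metricF R n psi.
  apply/funext => x; apply/funext => y.
  by rewrite /metricF /psi [`|enorm (bar x)|]ger0_norm // sqrtr_ge0.
have pe : eq_pos phi psi by move=> z rho rho0; rewrite /psi gtr0_norm.
have PE z rho : P n phi z rho = P n psi z rho by exact/eq_pos_extend0/eq_pos_P0.
have QE z rho : Q n phi z rho = Q n psi z rho by exact/eq_pos_extend0/eq_pos_Q0.
have Ppos z rho : 0 < rho -> P n psi z rho = P0 n psi z rho by exact: extend0_pos.
have Qpos z rho : 0 < rho -> Q n psi z rho = Q0 n psi z rho by exact: extend0_pos.
rewrite FE; split => [n2|n1]; split.
- case: n n2 {hn hphi FE} hpsi spsi PE QE Ppos Qpos => [//|[//|n]] _.
  move=> hpsi spsi PE QE Ppos Qpos Rf.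
  (* Orthogonal x-bar and y-bar isolate P, parallel ones then give Q. *)
  have P00 z t : 0 < t -> P0 n.+2 psi z t = 0.
    move=> t0; have := ricci_flat_coeff hpsi spsi ord0 ord_max z Rf t0.
    by rewrite mulr0 expr0n mul0r addr0.
  have Q00 z t : 0 < t -> Q0 n.+2 psi z t = 0.
    move=> t0; have := ricci_flat_coeff hpsi spsi ord0 ord0 z Rf t0.
    rewrite eqxx mulr1 P00 // add0r => /eqP; rewrite mulf_eq0 sqrf_eq0.
    by rewrite (gt_eqF t0) => /eqP.
  move=> z rho; rewrite PE QE le_eqVlt => /predU1P[<-|rho0].
    split; apply: extend0_axis; apply: (@near_eq0_at_right _ _ (fun=> 0)).
    - exact: P00.
    - exact: cvg_cst.
    - exact: Q00.
    - exact: cvg_cst.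
  by rewrite Ppos // Qpos // P00 // Q00.
- move=> PQ; apply: (ricci_flat_off_axis hpsi spsi (Ordinal hn)) => x y x0 y0.
  have rho0 := rad_gt0 x0; have [] := PQ (slope y) (rad x) (ltW rho0).
  rewrite PE QE Ppos // Qpos // Ric_off_axis // => -> ->.
  by rewrite !mulr0 addr0.
- move=> Rf z rho; rewrite PE QE.
  have E t : 0 < t -> P0 n psi z t + t ^+ 2 * Q0 n psi z t = 0.
    move=> t0; have := ricci_flat_coeff hpsi spsi (Ordinal hn) (Ordinal hn) z Rf t0.
    by rewrite eqxx mulr1.
  rewrite le_eqVlt => /predU1P[<-|rho0]; last by rewrite Ppos // Qpos // E.
  rewrite expr0n mul0r addr0; apply: extend0_axis.
  apply: (@near_eq0_at_right _ _ (fun t => - (t ^+ 2 * Q0 n psi z t))).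
    by move=> t t0; apply/eqP; rewrite -addr_eq0 E.
  by rewrite -[X in _ --> X]oppr0; apply: cvgN; exact: rho2_Q0_cvg.
- move=> PQ; apply: (ricci_flat_off_axis hpsi spsi (Ordinal hn)) => x y x0 y0.
  have rho0 := rad_gt0 x0; have := PQ (slope y) (rad x) (ltW rho0).
  rewrite PE QE Ppos // Qpos // Ric_off_axis // => E.
  have -> : bdot x y ^+ 2 = rad x ^+ 2 * rad y ^+ 2.
    rewrite -!bdot_self /bdot; move: (x) (y); rewrite n1 => u v.
    by rewrite !big_ord_recl !big_ord0; ring.
  transitivity (rad y ^+ 2 * (P0 n psi (slope y) (rad x)
      + rad x ^+ 2 * Q0 n psi (slope y) (rad x))); last by rewrite E mulr0.
  ring.
Qed.
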